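(* Let $r>4$, $1<k_1,k_2<r-1$, $\lambda_1\in\Lambda_n^{(k_1,r)}$ and $\lambda_2\in\Lambda_n^{(k_2,r)}$, neither of trivial type. Then (1) $\rho_{\lambda_1}^{(k_1,r)}$ is equivalent to $\psi\otimes\rho_{\lambda_2}^{(k_2,r)}$ for some character $\psi$ of $B_n$ if and only if $\lambda_1=\lambda_2$; (2) $\rho_{\lambda_1}^{(k_1,r)}$ is equivalent to $\psi\otimes(\rho_{\lambda_2}^{(k_2,r)})^*$ for some character $\psi$ of $B_n$ if and only if $\lambda_1=(\lambda_2)_r^*$.
   Context: Fix an integer $r\ge 3$ and $q=e^{\pm2\pi i/r}$, $q^{1/2}=e^{\pm\pi i/r}$, quantum integers $[m]=\frac{q^{m/2}-q^{-m/2}}{q^{1/2}-q^{-1/2}}$. A Young diagram $\lambda=[\lambda_1,\dots,\lambda_k]$, $\lambda_1\ge\dots\ge\lambda_k\ge0$, has $n=\sum\lambda_i$ boxes (diagrams differing only by empty rows are identified); standard tableaux are fillings by $1,\dots,n$ increasing in rows and columns. For $r\ge k+1$, $\lambda$ is $(k,r)$-admissible if $\lambda_1-\lambda_k\le r-k$; $\Lambda_n^{(k,r)}$ is the set of such diagrams with $n$ boxes. For a standard tableau $t$, $t^{(i)}$ deletes boxes containing $n,\dots,n-i+1$; $t$ is $(k,r)$-admissible if every $t^{(i)}$ has admissible shape. With entries $m,m'$ in rows $r_1,r_2$, columns $c_1,c_2$: $d_{t,m,m'}=(c_1-c_2)-(r_1-r_2)$; with $d=d_{t,i,i+1}$, $\alpha_{t,i}=\frac{[d+1]}{[2][d]}$,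 $\beta_{t,i}=\sqrt{\alpha_{t,i}(1-\alpha_{t,i})}$. $V_\lambda^{(k,r)}$ has orthonormal basis $\{v_t\}$ over admissible standard tableaux of shape $\lambda$; $E_iv_t=\alpha_{t,i}v_t+\beta_{t,i}v_{s_i(t)}$ if $s_i(t)$ ($i,i+1$ swapped) is an admissible standard tableau, else $E_iv_t=\alpha_{t,i}v_t$. Sector: $\rho_\lambda^{(k,r)}(\sigma_i)=q\,\mathrm{Id}-(1+q)E_i$. $\lambda$ is of trivial type if it is a single row or a single column or $k=r-1$. The $r$-tile of $\lambda$ with $k$ rows ($l=r-k$) is $T_\lambda=(t_{ij})_{k\times l}$, $t_{ij}=\lfloor(\lambda_i+l-j)/l\rfloor$; the $r$-conjugate $\lambda_r^*$ is the diagram whose $i$-th row length is the $i$-th row sum of the transpose of $T_\lambda$. $\rho^*$ denotes the contragredient representation. *)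

(* Defs.v *)
From HB Require Import structures.
From mathcomp Require Import all_boot all_order all_algebra.
From mathcomp Require Import reals trigo.
From mathcomp Require Import complex.

Set Implicit Arguments.
Unset Strict Implicit.
Unset Printing Implicit Defensive.

Import Order.TTheory GRing.Theory Num.Theory.
Local Open Scope ring_scope.

(* A Young diagram, normalized: nonincreasing positive row lengths
   (diagrams differing by empty rows are identified by dropping them). *)
Definition is_diagram (la : seq nat) : bool :=
  sorted geq la && all (fun x => 0 < x)%N la.

(* la is in Lambda_n^{(k,r)}: at most k (nonzero) rows, n boxes,
   la_1 - la_k <= r - k (la_k = 0 if la has fewer than k rows). *)
Definition in_Lambda (k r n : nat) (la : seq nat) : bool :=
  [&& is_diagram la, sumn la == n, (size la <= k)%N
    & (nth 0%N la 0 - nth 0%N la k.-1 <= r - k)%N].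

Definition trivial_type (k r : nat) (la : seq nat) : bool :=
  [|| (size la <= 1)%N, all (fun x => x <= 1)%N la | k == r.-1].

Definition r_conj (k r : nat) (la : seq nat) : seq nat :=
  let l := (r - k)%N in
  [seq x <- mkseq (fun j => \sum_(i < k) ((nth 0%N la i + l - j.+1) %/ l))%N l
     | x != 0%N].

(* A filling of n boxes: entry m+1 (m : 'I_n) sits in box (row, column)
   t m (0-indexed). *)
Definition tab (n : nat) := {ffun 'I_n -> 'I_n * 'I_n}.

Section Tableaux.
Variable n : nat.
Implicit Types (t : tab n) (la : seq nat).

Definition trow t (m : 'I_n) : nat := (t m).1.
Definition tcol t (m : 'I_n) : nat := (t m).2.

Definition standard la t : bool :=
  [&& is_diagram la, sumn la == n, injectiveb t,
      [forall m, tcol t m < nth 0%N la (trow t m)]%N,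
      [forall a : 'I_n, forall b : 'I_n,
          (b < nth 0%N la a)%N ==> ((a, b) \in codom t)],
      [forall m, forall m',
          (trow t m == trow t m') && (tcol t m < tcol t m')%N ==> (m < m')%N]
    & [forall m, forall m',
          (tcol t m == tcol t m') && (trow t m < trow t m')%N ==> (m < m')%N]].

(* shape of the subtableau formed by the boxes containing 1..j,
   i.e. of t^{(n-j)} *)
Definition sub_shape t (j : nat) : seq nat :=
  [seq x <- [seq #|[set m : 'I_n | (m < j)%N && (trow t m == a)]|
               | a <- iota 0 n] | x != 0%N].

Definition adm_tab (k r : nat) la t : bool :=
  standard la t && [forall j : 'I_n.+1, in_Lambda k r j (sub_shape t j)].

(* s_i(t): entries i and i+1 swapped (i 1-indexed, i.e. ordinals i-1, i) *)
Definition swap_ix (i : nat) (j : 'I_n) : 'I_n :=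
  insubd j (if val j == i.-1 then i else if val j == i then i.-1 else val j).
Definition sw (i : nat) t : tab n := [ffun j => t (swap_ix i j)].

(* position (row, column) of entry m (1-indexed) *)
Definition pos t (m : nat) : nat * nat :=
  match (insub m.-1 : option 'I_n) with
  | Some o => (trow t o, tcol t o)
  | None => (0%N, 0%N)
  end.

Definition dd t (i : nat) : int :=
  (((pos t i).2)%:Z - ((pos t i.+1).2)%:Z)
  - (((pos t i).1)%:Z - ((pos t i.+1).1)%:Z).

End Tableaux.

Section Reps.
Local Unset Implicit Arguments.
Variable R : realType.
Local Notation C := R[i].
Local Open Scope complex_scope.

Definition qhalf (sgn : bool) (r : nat) : C :=
  (cos (pi / r%:R))%:C + 'i * ((if sgn then 1 else -1) * sin (pi / r%:R))%:C.
Definition qq sgn r : C := qhalf sgn r ^+ 2.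

Definition qint sgn r (m : int) : C :=
  (qhalf sgn r ^ m - qhalf sgn r ^ (- m)) / (qhalf sgn r - (qhalf sgn r)^-1).

Definition alpha sgn r n (t : tab n) (i : nat) : C :=
  let d := dd t i in qint sgn r (d + 1) / (qint sgn r 2 * qint sgn r d).
Definition beta sgn r n (t : tab n) (i : nat) : C :=
  sqrtC (alpha sgn r n t i * (1 - alpha sgn r n t i)).

Definition basis (k r n : nat) (la : seq nat) : pred (tab n) :=
  [pred t | adm_tab k r la t].
Definition dimV k r n la := #|basis k r n la|.

(* matrix of E_i in the orthonormal basis {v_t}: column t holds E_i v_t *)
Definition Emx sgn k r n la (i : nat) : 'M[C]_(dimV k r n la) :=
  \matrix_(a, b)
    let t := enum_val b in let t' := enum_val a in
    (if t' == t then alpha sgn r n t i else 0)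
    + (if t' == sw i t then beta sgn r n t i else 0).

Definition rho sgn k r n la (i : nat) : 'M[C]_(dimV k r n la) :=
  qq sgn r *: 1%:M - (1 + qq sgn r) *: Emx sgn k r n la i.

End Reps.

(* A homomorphism out of B_n = < sigma_1..sigma_{n-1} | braid relations >
   is given by the images of the generators; two representations agree /
   are equivalent iff they are so on generators. *)

Section Braid.
Variable F : fieldType.

(* psi : B_n -> F^x a character (one-dimensional representation),
   given by psi i = psi(sigma_i), 1 <= i <= n-1. *)
Definition is_character (n : nat) (psi : nat -> F) : Prop :=
  [/\ (forall i, (0 < i < n)%N -> psi i != 0),
      (forall i j, (0 < i < n)%N -> (0 < j < n)%N -> (i.+1 < j)%N ->
          psi i * psi j = psi j * psi i)
    & (forall i, (0 < i)%N -> (i.+1 < n)%N ->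
          psi i * psi i.+1 * psi i = psi i.+1 * psi i * psi i.+1)].

Definition tensor_char (d : nat) (psi : nat -> F) (rh : nat -> 'M[F]_d) :=
  fun i => psi i *: rh i.

Definition contragredient (d : nat) (rh : nat -> 'M[F]_d) :=
  fun i => (invmx (rh i))^T.

Definition rep_equiv (n d1 d2 : nat) (rh1 : nat -> 'M[F]_d1)
    (rh2 : nat -> 'M[F]_d2) : Prop :=
  exists P : 'M[F]_(d1, d2),
    [/\ row_free P, row_full P &
        forall i, (0 < i < n)%N -> rh1 i *m P = P *m rh2 i].

End Braid.

(* Main.v *)
(* Write [B_i] for the image of [sigma_i] and [D_m] for the diagonal matrix of
   the numbers [q ^ (content of the entry m)].  Then [D_1 = 1] and
   [B_m D_m = D_(m+1) (B_m + 1 - q)] (Jucys-Murphy elements), so an intertwiner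
   of two sectors commutes with the [D_m]: a nonzero entry pairs two tableaux
   with the same contents modulo [r].  An admissible tableau is a sequence of
   boxes added to an order ideal of a cylindric order, and boxes addable to the
   same ideal have distinct contents modulo [r]; hence the two tableaux
   coincide and so do the shapes.  The character is trivial because [B_1] has
   both eigenvalues [q] and [-1], and [{q, -1} = {c q, -c}] forces [c = 1].
   For the contragredient, [B^-1 = - q^-1 (q - (1 + q) (1 - E))], and the box
   bijection [(i, c) |-> (c mod l, k (c / l) + i)] exchanges the cylindric
   orders of [(k, l)] and [(l, k)] while negating contents modulo [r], which
   replaces [alpha] by [1 - alpha]; the sign of [beta] is corrected by a
   function of tableaux that is alternating under [s_i]. *)
Require Import Defs.
From HB Require Import structures.
From mathcomp Require Import all_boot all_order all_algebra.
From mathcomp Require Import reals trigo.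
From mathcomp Require Import complex.
From mathcomp Require Import perm.
From mathcomp Require Import zify ring.

Set Implicit Arguments.
Unset Strict Implicit.
Unset Printing Implicit Defensive.

Import Order.TTheory GRing.Theory Num.Theory.
Local Open Scope ring_scope.

(** * Cylindric order and growth of diagrams *)

(* Covering relation of the cylindric order on boxes; the last case encodes
   the condition [la_1 - la_k <= l]. *)
Definition prec (k l : nat) (a b : nat * nat) : bool :=
  [|| (a.1 == b.1) && (a.2.+1 == b.2), (a.1.+1 == b.1) && (a.2 == b.2)
    | [&& a.1.+1 == k, b.1 == 0 & a.2 + l == b.2]]%N.

(* [T m] is the box holding the entry [m.+1]. *)
Definition growth (k l : nat) (T : nat -> nat * nat) (n : nat) : Prop :=
  forall m, (m < n)%N ->
  [/\ ((T m).1 < k)%N, forall j, (j < m)%N -> T j <> T m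
    & forall a, prec k l a (T m) -> exists2 j, (j < m)%N & T j = a].

Definition row_len (T : nat -> nat * nat) (m i : nat) : nat :=
  count (fun b => b.1 == i) (mkseq T m).

Definition content (b : nat * nat) : int := b.2%:Z - b.1%:Z.

(** Such a list is an initial segment of the naturals: it contains [iota 0 x.+1] when it contains
    [x], and lies inside [iota 0 x] otherwise. Comparing sizes gives both directions. *)
Lemma mem_down_closed (s : seq nat) : uniq s ->
  (forall x, x.+1 \in s -> x \in s) ->
  forall x, (x \in s) = (x < size s)%N.
Proof.
move=> us ds x.
have down y d : (y + d)%N \in s -> y \in s.
  elim: d => [|d IH]; first by rewrite addn0.
  by rewrite addnS => /ds /IH.
apply/idP/idP => [xs|].
  rewrite -[x.+1](size_iota 0); apply: uniq_leq_size; first exact: iota_uniq.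
  move=> y; rewrite mem_iota => /andP[_ yx].
  by apply: (down _ (x - y)%N); rewrite subnKC.
apply: contraTT => nxs; rewrite -leqNgt -[X in (_ <= X)%N](size_iota 0).
apply: uniq_leq_size => // y ys; rewrite mem_iota add0n /=.
rewrite ltnNge; apply: contra nxs => xy.
by apply: (down _ (y - x)%N); rewrite subnKC.
Qed.

Lemma mem_mkseqP (T : nat -> nat * nat) m b :
  reflect (exists2 j, (j < m)%N & T j = b) (b \in mkseq T m).
Proof.
apply: (iffP mapP) => [[j]|[j jm <-]].
  by rewrite mem_iota => /andP[_ jm] ->; exists j.
by exists j => //; rewrite mem_iota.
Qed.

Section Growth.
Variables (k l n : nat) (T : nat -> nat * nat).
Hypothesis gT : growth k l T n.

Lemma growth_inj i j : (i < n)%N -> (j < n)%N -> T i = T j -> i = j.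
Proof.
move=> i_n jn e; case: (ltngtP i j) => // h.
  by case: (gT jn) => _ /(_ _ h).
by case: (gT i_n) => _ /(_ _ h) ne _; case: ne.
Qed.

Lemma mkseq_growth_uniq m : (m <= n)%N -> uniq (mkseq T m).
Proof.
move=> mn; rewrite map_inj_in_uniq ?iota_uniq // => i j.
rewrite !mem_iota => /andP[_ im] /andP[_ jm].
by apply: growth_inj; [apply: leq_trans im _|apply: leq_trans jm _].
Qed.

(** The occupied columns of a row form a set closed under predecessor, by the horizontal covers.
    Membership of a box thereby becomes an inequality. *)
Lemma mem_row_len m i c : (m <= n)%N ->
  ((i, c) \in mkseq T m) = (c < row_len T m i)%N.
Proof.
move=> mn; pose s := [seq b.2 | b <- mkseq T m & b.1 == i].
have memE x : ((i, x) \in mkseq T m) = (x \in s).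
  apply/idP/mapP => [h|[[i' c'] /=]].
    by exists (i, x) => //; rewrite mem_filter eqxx.
  by rewrite mem_filter => /= /andP[/eqP-> h] ->.
have -> : row_len T m i = size s by rewrite size_map size_filter.
rewrite memE mem_down_closed //.
  rewrite map_inj_in_uniq ?filter_uniq ?mkseq_growth_uniq //.
  move=> [a1 a2] [b1 b2]; rewrite !mem_filter /=.
  by move=> /andP[/eqP-> _] /andP[/eqP-> _] ->.
move=> x; rewrite -!memE => /mem_mkseqP[j jm Tj].
case: (gT (leq_trans jm mn)) => _ _ /(_ (i, x)).
rewrite Tj /prec /= !eqxx => /(_ isT)[j' j'j Tj'].
by apply/mem_mkseqP; exists j' => //; apply: ltn_trans jm.
Qed.

Lemma prec_mem m a b : (m <= n)%N -> prec k l a b ->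
  b \in mkseq T m -> a \in mkseq T m.
Proof.
move=> mn ab /mem_mkseqP[j jm Tj].
case: (gT (leq_trans jm mn)) => _ _ /(_ a).
rewrite Tj => /(_ ab)[j' j'j Tj'].
by apply/mem_mkseqP; exists j' => //; apply: ltn_trans jm.
Qed.

Lemma row_len_noninc m i : (m <= n)%N ->
  (row_len T m i.+1 <= row_len T m i)%N.
Proof.
move=> mn; rewrite leqNgt; apply/negP; rewrite -mem_row_len //.
move=> h; have := @prec_mem m (i, row_len T m i) _ mn _ h.
by rewrite mem_row_len // ltnn /prec /= !eqxx orbT => /(_ isT).
Qed.

Lemma row_len_mono m i j : (m <= n)%N -> (i <= j)%N ->
  (row_len T m j <= row_len T m i)%N.
Proof.
move=> mn /subnKC <-; elim: (j - i)%N => [|d IH]; first by rewrite addn0.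
by rewrite addnS; apply: leq_trans IH; apply: row_len_noninc.
Qed.

(** Comes from the wrap-around covers: a box in column [c + l] of row 0 requires column [c] of row
    [k.-1]. *)
Lemma row_len_cyl m : (0 < k)%N -> (m <= n)%N ->
  (row_len T m 0 <= row_len T m k.-1 + l)%N.
Proof.
move=> k0 mn; rewrite leqNgt; apply/negP; rewrite -mem_row_len //.
move=> h; have := @prec_mem m (k.-1, row_len T m k.-1) _ mn _ h.
by rewrite mem_row_len // ltnn /prec /= prednK // !eqxx /= !orbT => /(_ isT).
Qed.

(** The new box ends its row: its left neighbour is already present, while the box itself is not. *)
Lemma growth_col m : (m < n)%N -> (T m).2 = row_len T m (T m).1.
Proof.
move=> mn; have [_ nT pT] := gT mn; apply/eqP; rewrite eqn_leq.
apply/andP; split; last first.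
  rewrite leqNgt -mem_row_len; last exact: ltnW.
  by rewrite -surjective_pairing; apply/mem_mkseqP => -[j /nT].
case E: (T m).2 => [//|c]; rewrite -mem_row_len; last exact: ltnW.
by apply/mem_mkseqP/pT; rewrite /prec /= E !eqxx.
Qed.

(** By strong induction, since a box off row 0 needs the box above it and a box off column 0 needs
    the box to its left. Hence the first [n] boxes fit into ['I_n * 'I_n]. *)
Lemma growth_bound m : (m < n)%N -> ((T m).1 <= m)%N /\ ((T m).2 <= m)%N.
Proof.
elim/ltn_ind: m => m IH mn; have [_ _ pT] := gT mn.
case E: (T m) => [i c] /=; split.
  case: i E => // i E; have [|j jm Tj] := pT (i, c).
    by rewrite /prec E /= !eqxx orbT.
  by have [] := IH j jm (ltn_trans jm mn); rewrite Tj /= => h _; apply: leq_ltn_trans jm.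
case: c E => // c E; have [|j jm Tj] := pT (i, c).
  by rewrite /prec E /= !eqxx.
by have [] := IH j jm (ltn_trans jm mn); rewrite Tj /= => _ h; apply: leq_ltn_trans jm.
Qed.

Lemma row_len0 m i : (m <= n)%N -> (minn k n <= i)%N -> row_len T m i = 0%N.
Proof.
move=> mn ki; apply/eqP; rewrite -leqn0 leqNgt -mem_row_len //.
apply/mem_mkseqP => -[j jm Tj].
have jn := leq_trans jm mn; have [+ _] := growth_bound jn.
by case: (gT jn); rewrite Tj /=; lia.
Qed.

(** The two arguments are the first free boxes of rows [i < j]. Their contents differ by the
    difference of row lengths, between 0 and [l], plus [j - i], between 1 and [k - 1]. *)
Lemma content_gap m i j : (m <= n)%N -> (i < j < k)%N ->
  0 < content (i, row_len T m i) - content (j, row_len T m j) < (k + l)%:Z.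
Proof.
move=> mn /andP[ij jk]; rewrite /content /=.
have h1 := row_len_mono mn (ltnW ij).
have k0 : (0 < k)%N by lia.
have h2 := row_len_cyl k0 mn.
have h3 : (row_len T m k.-1 <= row_len T m j)%N by apply: row_len_mono => //; lia.
have h4 : (row_len T m i <= row_len T m 0)%N by apply: row_len_mono.
lia.
Qed.

End Growth.

(** * Contents modulo [k + l] separate the boxes addable to one ideal *)

Lemma dvdz_gap (r : nat) (x : int) : 0 < x < r%:Z -> ~~ (r %| x)%Z.
Proof.
case: x => // x /andP[x0 xr]; rewrite /dvdz /=.
by apply/negP => /dvdn_leq; lia.
Qed.

(** The two sequences may live on different cylinders with the same [k + l]. Of the two row indices
    the larger one decides which cylinder supplies the gap estimate. *)
Lemma content_inj k1 l1 T1 n1 k2 l2 T2 n2 m : growth k1 l1 T1 n1 ->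
  growth k2 l2 T2 n2 -> (k1 + l1 = k2 + l2)%N -> (m <= n1)%N -> (m <= n2)%N ->
  mkseq T1 m = mkseq T2 m ->
  forall i j, (i < k1)%N -> (j < k2)%N ->
  ((k1 + l1)%N %| content (i, row_len T1 m i) - content (j, row_len T2 m j))%Z ->
  i = j.
Proof.
move=> g1 g2 kl mn1 mn2 eqT i j ik jk.
have eqr : row_len T1 m =1 row_len T2 m by move=> x; rewrite /row_len eqT.
case: (ltngtP i j) => // h.
  have := @content_gap _ _ _ _ g2 m i j mn2; rewrite h jk => /(_ isT).
  by move=> /dvdz_gap; rewrite -kl -(eqr i) => /negbTE->.
have := @content_gap _ _ _ _ g1 m j i mn1; rewrite h ik => /(_ isT).
by move=> /dvdz_gap; rewrite -(eqr j) -opprB rpredN (eqr j) => /negbTE->.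
Qed.

(** By induction on the prefix: both next boxes are first free boxes of the same set of boxes, so
    congruent contents force the same row and then the same column. *)
Lemma growth_unique k1 l1 T1 k2 l2 T2 n : growth k1 l1 T1 n ->
  growth k2 l2 T2 n -> (k1 + l1 = k2 + l2)%N ->
  (forall m, (m < n)%N ->
     ((k1 + l1)%N %| content (T1 m) - content (T2 m))%Z) ->
  mkseq T1 n = mkseq T2 n.
Proof.
move=> g1 g2 kl ct.
suff H m : (m <= n)%N -> mkseq T1 m = mkseq T2 m by exact: H.
elim: m => // m IH mn; rewrite !mkseqS IH 1?ltnW //; congr rcons.
have [k1m _ _] := g1 _ mn; have [k2m _ _] := g2 _ mn.
have c1 := growth_col g1 mn; have c2 := growth_col g2 mn.
have eqT := IH (ltnW mn).
have := ct _ mn; rewrite (surjective_pairing (T1 m)) (surjective_pairing (T2 m)).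
rewrite c1 c2 => /(content_inj g1 g2 kl (ltnW mn) (ltnW mn) eqT k1m k2m) e.
by rewrite e /row_len eqT.
Qed.

Definition swapT (m : nat) (T : nat -> nat * nat) (j : nat) : nat * nat :=
  if j == m then T m.+1 else if j == m.+1 then T m else T j.

Lemma growth_swap k l n T m : growth k l T n -> (m.+1 < n)%N ->
  ~~ prec k l (T m) (T m.+1) -> growth k l (swapT m T) n.
Proof.
move=> gT mn np.
have [k1 n1 p1] := gT _ (ltnW mn); have [k2 n2 p2] := gT _ mn.
move=> j jn; rewrite {1 3 4}/swapT.
case: (eqVneq j m) => [->|jm].
  split=> // [i im|a pa].
    have -> : swapT m T i = T i by rewrite /swapT !ifF //; lia.
    by apply: n2; lia.
  (* A predecessor of [T m.+1] is not [T m], so it was placed before position [m] and the swap does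
     not disturb it. *)
  have [i im Ti] := p2 _ pa; exists i; last first.
    rewrite /swapT; case: eqVneq => [e|_]; last by rewrite ifF //; lia.
    by move: np; rewrite -{1}e Ti pa.
  rewrite ltnS leq_eqVlt in im; case/orP: im => // /eqP e.
  by move: np; rewrite -{1}e Ti pa.
case: (eqVneq j m.+1) => [->|jm1].
  split=> // [i im|a pa].
    rewrite /swapT; case: eqVneq => [_|im']; first by move/esym; apply: n2.
    by rewrite ifF; [apply: n1; lia|lia].
  have [i im Ti] := p1 _ pa; exists i; first by lia.
  by rewrite /swapT !ifF //; lia.
have [kj nj pj] := gT _ jn.
split=> // [i ij|a pa].
  rewrite /swapT; case: eqVneq => [e|_]; first by apply: nj; lia.
  by case: eqVneq => [e|_]; apply: nj; lia.
have [i ij Ti] := pj _ pa.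
case: (eqVneq i m) => [e|im].
  by exists m.+1; [lia|rewrite /swapT eqxx ifF -?e //; lia].
case: (eqVneq i m.+1) => [e|im1].
  by exists m; [lia|rewrite /swapT eqxx -e].
by exists i => //; rewrite /swapT (negbTE im) (negbTE im1).
Qed.

(** If consecutive boxes are unrelated, exchanging them gives a growth sequence with the same first
    [m] boxes. Both boxes are thus addable to one ideal, and [content_inj] separates them. *)
Lemma growth_content_step k l n T m : growth k l T n -> (m.+1 < n)%N ->
  ~~ prec k l (T m) (T m.+1) ->
  ~~ ((k + l)%N %| content (T m) - content (T m.+1))%Z.
Proof.
move=> gT mn np; have gS := growth_swap gT mn np.
have mn' := ltnW mn.
have eqT : mkseq T m = mkseq (swapT m T) m.
  apply/eq_in_map => j; rewrite mem_iota => /andP[_ jm].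
  by rewrite /swapT !ifF //; lia.
have c1 := growth_col gT mn'; have c2 := growth_col gS mn'.
have [k1 _ _] := gT _ mn'; have [k2 n2 _] := gT _ mn.
have S1 : swapT m T m = T m.+1 by rewrite /swapT eqxx.
rewrite S1 in c2.
rewrite (surjective_pairing (T m)) (surjective_pairing (T m.+1)) c1 c2.
apply/negP => /(content_inj gT gS erefl (ltnW mn') (ltnW mn') eqT k1 k2) e.
apply: (n2 m) => //.
rewrite (surjective_pairing (T m)) (surjective_pairing (T m.+1)) c1 c2.
by rewrite e /row_len eqT.
Qed.

(** Modulo [k + l] the wrap-around cover behaves like the vertical one, as row [k] is row 0 shifted
    by [l] columns. *)
Lemma prec_content k l a b : prec k l a b ->
  [\/ content a - content b = - 1, content a - content b = 1
    | content a - content b = 1 - (k + l)%N%:Z].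
Proof.
case: a b => [a1 a2] [b1 b2]; rewrite /prec /content /=.
case/or3P => [/andP[/eqP-> /eqP<-]|/andP[/eqP<- /eqP<-]|/and3P[/eqP<- /eqP-> /eqP<-]].
- by apply: Or31; lia.
- by apply: Or32; lia.
- by apply: Or33; lia.
Qed.

(** * Conjugation of boxes between the two cylinders *)

(* Wraps a row into columns of height [l]: this realizes the [r]-conjugation
   [T_la |-> T_la^T] on boxes. *)
Definition conj_box (k l : nat) (b : nat * nat) : nat * nat :=
  ((b.2 %% l)%N, (k * (b.2 %/ l) + b.1)%N).

Lemma divn_modn_MD d x y : (y < d)%N ->
  ((d * x + y) %/ d = x)%N /\ ((d * x + y) %% d = y)%N.
Proof.
move=> yd; have d0 : (0 < d)%N by apply: leq_ltn_trans yd.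
by rewrite mulnC divnMDl // divn_small // addn0 modnMDl modn_small.
Qed.

Lemma conj_boxK k l b : (0 < l)%N -> (b.1 < k)%N ->
  conj_box l k (conj_box k l b) = b.
Proof.
case: b => i c l0 /= ik; rewrite /conj_box /=.
have [-> ->] := divn_modn_MD (c %/ l) ik.
by rewrite mulnC -divn_eq.
Qed.

Lemma conj_box_row k l b : (0 < l)%N -> ((conj_box k l b).1 < l)%N.
Proof. by move=> l0; rewrite ltn_pmod. Qed.

Lemma content_conj_box k l b :
  content (conj_box k l b) = (k + l)%N%:Z * (b.2 %/ l)%N%:Z - content b.
Proof.
case: b => i c; rewrite /content /=.
have -> : c%:Z = (c %/ l)%N%:Z * l%:Z + (c %% l)%N%:Z.
  by rewrite {1}(divn_eq c l) PoszD PoszM.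
by rewrite !PoszD PoszM; ring.
Qed.

(** A horizontal cover below the image comes from a vertical cover, or from a wrap-around one when
    [b] lies in row 0. Vertical and wrap-around covers below the image both come from horizontal
    ones. *)
Lemma prec_conj_box k l a b : (0 < l)%N -> (b.1 < k)%N ->
  prec l k a (conj_box k l b) ->
  prec k l (conj_box l k a) b /\ conj_box k l (conj_box l k a) = a.
Proof.
case: a b => [a1 a2] [i c] l0 /= ik p.
have k0 : (0 < k)%N by apply: leq_ltn_trans ik.
have cl := ltn_pmod c l0.
have a1l : (a1 < l)%N.
  move: p; rewrite /prec /conj_box /=.
  by move: (c %% l)%N (c %/ l)%N cl => x y; lia.
split; last by rewrite conj_boxK.
move: p; rewrite /prec /conj_box /= [in X in _ -> X](divn_eq c l) (mulnC _ l).
move: (c %% l)%N (c %/ l)%N cl => s x sl /or3P[|/andP[/eqP e1 /eqP e2]|].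
- case: i ik => [|i] ik /andP[/eqP-> /eqP].
    rewrite addn0; case: x => [|x]; first by rewrite muln0.
    move=> e; have {e} -> : a2 = (k * x + k.-1)%N by rewrite mulnS in e; lia.
    have [|-> ->] := @divn_modn_MD k x k.-1; first by rewrite prednK.
    by rewrite prednK // mulnS; apply/or3P/Or33; rewrite !eqxx /=; lia.
  rewrite addnS => -[->].
  have [|-> ->] := @divn_modn_MD k x i; first exact: ltnW.
  by rewrite !eqxx orbT.
- rewrite e2; have [-> ->] := divn_modn_MD x ik.
  by apply/or3P/Or31; rewrite eqxx; lia.
- move=> /and3P[/eqP e1 /eqP e2 /eqP e3].
  case: x e3 => [|x] e3; first by move: e3; rewrite muln0; lia.
  have -> : a2 = (k * x + i)%N by rewrite mulnS in e3; lia.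
  have [-> ->] := divn_modn_MD x ik.
  by apply/or3P/Or31; rewrite eqxx mulnS; lia.
Qed.

Lemma growth_conj k l T n : (0 < l)%N -> growth k l T n ->
  growth l k (conj_box k l \o T) n.
Proof.
move=> l0 gT m mn; have [km nm pm] := gT _ mn; split=> /=.
- exact: conj_box_row.
- move=> j jm e; apply: (nm j) => //; have [kj _ _] := gT _ (ltn_trans jm mn).
  by rewrite -(conj_boxK l0 kj) e conj_boxK.
- move=> a /(prec_conj_box l0 km)[/pm[j jm Tj] e].
  by exists j; rewrite //= Tj.
Qed.

(** * Diagrams traced out by growth sequences *)

Definition shape (T : nat -> nat * nat) (m N : nat) : seq nat :=
  [seq x <- mkseq (row_len T m) N | x != 0%N].

(** The zeros of a nonincreasing function come last, so the filter only truncates and no index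
    shifts. *)
Lemma nth_filter_noninc (f : nat -> nat) N :
  (forall i, (f i.+1 <= f i)%N) -> (forall i, (N <= i)%N -> f i = 0%N) ->
  forall i, nth 0%N [seq x <- mkseq f N | x != 0%N] i = f i.
Proof.
elim: N f => [|N IH] f fd f0 i; first by rewrite nth_nil f0.
have -> : mkseq f N.+1 = f 0%N :: mkseq (f \o succn) N.
  by rewrite /mkseq /= -[1%N]addn0 iotaDl -map_comp.
have IH' := IH (f \o succn) (fun i => fd i.+1) (fun i h => f0 i.+1 h).
rewrite /=; case: eqP => [e|_] /=; last by case: i => //= i; rewrite IH'.
have z j : f j = 0%N by elim: j => // j e'; have := fd j; lia.
by rewrite IH' /= !z.
Qed.

Lemma is_diagram_filter (f : nat -> nat) N :
  (forall i, (f i.+1 <= f i)%N) -> (forall i, (N <= i)%N -> f i = 0%N) ->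
  is_diagram [seq x <- mkseq f N | x != 0%N].
Proof.
move=> fd f0; apply/andP; split.
  by apply/(sortedP 0%N) => i _; rewrite /= !nth_filter_noninc //; apply: fd.
by apply/allP => x; rewrite mem_filter lt0n => /andP[].
Qed.

Lemma is_diagram_size la k : is_diagram la -> nth 0%N la k = 0%N ->
  (size la <= k)%N.
Proof.
case/andP=> _ /allP p e; rewrite leqNgt; apply/negP => h.
by have := p _ (mem_nth 0%N h); rewrite e.
Qed.

(** Rows are positive, so the default value 0 of [nth] marks the end of a diagram and the lengths
    agree too. *)
Lemma is_diagram_ext la mu : is_diagram la -> is_diagram mu ->
  (forall i, nth 0%N la i = nth 0%N mu i) -> la = mu.
Proof.
move=> dl dm e; apply: (@eq_from_nth _ 0%N) => [|i _]; last exact: e.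
apply/eqP; rewrite eqn_leq; apply/andP; split.
  by apply: is_diagram_size => //; rewrite e nth_default.
by apply: is_diagram_size => //; rewrite -e nth_default.
Qed.

Lemma is_diagram_noninc la i : is_diagram la ->
  (nth 0%N la i.+1 <= nth 0%N la i)%N.
Proof.
case/andP=> /(sortedP 0%N) s _; have [h|h] := ltnP i.+1 (size la).
  exact: s.
by rewrite nth_default.
Qed.

Lemma is_diagram_mono la i j : is_diagram la -> (i <= j)%N ->
  (nth 0%N la j <= nth 0%N la i)%N.
Proof.
move=> dl /subnKC <-; elim: (j - i)%N => [|d IH]; first by rewrite addn0.
by rewrite addnS; apply: leq_trans IH; apply: is_diagram_noninc.
Qed.

Lemma sumn_shape T m N : (forall j, (j < m)%N -> ((T j).1 < N)%N) ->
  sumn (shape T m N) = m.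
Proof.
move=> TN; have -> : sumn (shape T m N) = sumn (mkseq (row_len T m) N).
  by rewrite /shape; elim: (mkseq _ _) => // -[|x] s /= ->.
rewrite sumnE big_map -[X in iota 0 X]subn0 -/(index_iota 0 N) big_mkord.
elim: m TN => [|m IH] TN; first by rewrite big1.
have -> : (\sum_(i < N) row_len T m.+1 i
    = \sum_(i < N) row_len T m i + \sum_(i < N) ((T m).1 == i))%N.
  rewrite -big_split; apply: eq_bigr => i _.
  by rewrite /row_len mkseqS -cats1 count_cat /= addn0.
rewrite IH => [|j jm]; last by apply: TN; apply: ltnW.
rewrite (bigD1 (Ordinal (TN m (ltnSn m)))) //= eqxx big1 => [|i]; first by lia.
by rewrite -val_eqE /= eq_sym => /negbTE->.
Qed.

Section GrowthShape.
Variables (k l n : nat) (T : nat -> nat * nat).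
Hypothesis gT : growth k l T n.

(** All occupied rows lie below [minn k n]. Leaving [N] free covers both [sub_shape], where [N] is
    [n], and [r_conj], where it is [r - k]. *)
Lemma nth_shape m N i : (m <= n)%N -> (minn k n <= N)%N ->
  nth 0%N (shape T m N) i = row_len T m i.
Proof.
move=> mn kN; apply: nth_filter_noninc => j; first exact: row_len_noninc gT _ _ mn.
by move=> Nj; apply: (row_len0 gT) => //; apply: leq_trans Nj.
Qed.

Lemma shape_diagram m N : (m <= n)%N -> (minn k n <= N)%N ->
  is_diagram (shape T m N).
Proof.
move=> mn kN; apply: is_diagram_filter => j; first exact: row_len_noninc gT _ _ mn.
by move=> Nj; apply: (row_len0 gT) => //; apply: leq_trans Nj.
Qed.

Lemma sumn_growth_shape m N : (m <= n)%N -> (minn k n <= N)%N ->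
  sumn (shape T m N) = m.
Proof.
move=> mn kN; apply: sumn_shape => j jm; have jn := leq_trans jm mn.
by have [h _ _] := gT jn; have [] := growth_bound gT jn; lia.
Qed.

Lemma in_Lambda_shape r m N : (0 < k)%N -> (r - k = l)%N -> (m <= n)%N ->
  (minn k n <= N)%N -> in_Lambda k r m (shape T m N).
Proof.
move=> k0 rk mn kN; apply/and4P; split; first exact: shape_diagram.
- by rewrite sumn_growth_shape.
- apply: is_diagram_size; first exact: shape_diagram.
  by rewrite nth_shape // (row_len0 gT) // geq_minl.
- by rewrite !nth_shape // rk leq_subLR (row_len_cyl gT).
Qed.

End GrowthShape.

Lemma row_len_eq_growth k l n T k' l' n' T' m m' :
  growth k l T n -> growth k' l' T' n' -> (m <= n)%N -> (m' <= n')%N ->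
  mkseq T m =i mkseq T' m' -> row_len T m =1 row_len T' m'.
Proof.
move=> g g' mn mn' e i; apply/eqP; rewrite eqn_leq; apply/andP; split.
  by rewrite leqNgt -(mem_row_len g) // e (mem_row_len g') // ltnn.
by rewrite leqNgt -(mem_row_len g') // -e (mem_row_len g) // ltnn.
Qed.

(** * Admissible tableaux as growth sequences *)

(** Zero-based and total, with value [(0, 0)] from [n] on, so that [growth] applies to tableaux. *)
Definition entry n (t : tab n) (m : nat) : nat * nat := pos t m.+1.

Lemma entry_ord n (t : tab n) (m : 'I_n) : entry t m = (trow t m, tcol t m).
Proof. by rewrite /entry /pos /= valK. Qed.

Lemma entry_inj n (t t' : tab n) : mkseq (entry t) n = mkseq (entry t') n ->
  t = t'.
Proof.
move=> e; apply/ffunP => m.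
have := congr1 (fun s => nth (0, 0)%N s m) e; rewrite !nth_mkseq //.
rewrite !entry_ord /trow /tcol; case: (t m) (t' m) => [a b] [c d] /= [h1 h2].
by congr pair; apply: val_inj.
Qed.

Lemma sub_shapeE n (t : tab n) j : (j <= n)%N ->
  sub_shape t j = shape (entry t) j n.
Proof.
move=> jn; congr filter; apply: eq_map => a.
rewrite /row_len /mkseq count_map -sum1_card.
have -> : count (preim (entry t) (fun b => b.1 == a)) (iota 0 j)
    = count (fun m => (m < j)%N && ((entry t m).1 == a)) (iota 0 n).
  rewrite -[X in _ = count _ (iota 0 X)](subnKC jn) iotaD count_cat add0n.
  rewrite [X in (_ + X)%N](_ : _ = 0%N) ?addn0.
    by apply: eq_in_count => m; rewrite mem_iota /= => ->.
  by apply/eqP; rewrite -leqn0 leqNgt -has_count; apply/hasPn => m;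
     rewrite mem_iota => /andP[h _]; rewrite ltnNge h.
rewrite -sum1_count -[X in iota 0 X]subn0 -/(index_iota 0 n) big_mkord.
by apply: eq_bigl => m; rewrite inE entry_ord.
Qed.

(** On the cylinder [(n, n)] no wrap-around cover can occur because all columns are below [n]; what
    remains is the usual order on boxes. *)
Lemma standard_growth n la (t : tab n) : standard la t -> growth n n (entry t) n.
Proof.
case/and5P=> dl _ /injectiveP ti /forallP lt /and3P[/forallP ct /forallP rt].
move=> /forallP colt m mn; pose o := Ordinal mn.
have -> : m = o by []; rewrite entry_ord.
split; first exact: ltn_ord.
  move=> j jm; pose oj := Ordinal (ltn_trans jm mn).
  have -> : j = oj by []; rewrite entry_ord => -[e1 e2].
  suff : oj = o by move/(congr1 val) => /= e; have := jm; rewrite e ltnn.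
  apply: ti; rewrite [t oj]surjective_pairing [t o]surjective_pairing.
  by congr pair; apply: val_inj.
move=> [a1 a2] p; have lto := lt o.
have a1n : (a1 < n)%N.
  move: p; rewrite /prec /=; have := ltn_ord (t o).1; have := ltn_ord (t o).2.
  by rewrite /trow /tcol; lia.
have a2n : (a2 < n)%N.
  move: p; rewrite /prec /=; have := ltn_ord (t o).1; have := ltn_ord (t o).2.
  by rewrite /trow /tcol; lia.
have ala : (a2 < nth 0%N la a1)%N.
  move: p; case/or3P => [/= /andP[/eqP e1 /eqP e2]|/= /andP[/eqP e1 /eqP e2]|].
  - by rewrite e1; lia.
  - by have := is_diagram_noninc a1 dl; rewrite e1 e2; lia.
  - by move=> /= /and3P[_ _ /eqP]; have := ltn_ord (t o).2; rewrite /tcol; lia.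
have := forallP (ct (Ordinal a1n)) (Ordinal a2n); rewrite /= ala /= => /codomP[j tj].
have ej : entry t j = (a1, a2) by rewrite entry_ord /trow /tcol -tj.
exists (val j) => //; case/or3P: p => /=.
- case/andP=> /eqP e1 /eqP e2; have := forallP (rt j) o.
  by rewrite /trow /tcol -tj /= -/(trow t o) -/(tcol t o) -e1 -e2 eqxx ltnSn.
- case/andP=> /eqP e1 /eqP e2; have := forallP (colt j) o.
  by rewrite /trow /tcol -tj /= -/(trow t o) -/(tcol t o) -e1 -e2 eqxx ltnSn.
- by move=> /= /and3P[_ _ /eqP]; have := ltn_ord (t o).2; rewrite /tcol; lia.
Qed.

Lemma standard_row_len n la (t : tab n) i : standard la t ->
  nth 0%N la i = row_len (entry t) n i.
Proof.
move=> st; have gt := standard_growth st.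
case/and5P: st => dl /eqP sl _ /forallP lt /and3P[/forallP ct _ _].
have lan j : (nth 0%N la j <= n)%N.
  rewrite -sl; elim: (la) j {dl sl lt ct} => [|x s IH] [|j] //=; first exact: leq_addr.
  by apply: leq_trans (IH j) _; apply: leq_addl.
have szn : (size la <= n)%N.
  rewrite -sl; case/andP: dl => _; elim: (la) => //= x s IH /andP[x0 /IH]; lia.
have memE c : (c < nth 0%N la i)%N = ((i, c) \in mkseq (entry t) n).
  apply/idP/mem_mkseqP => [h|[j jn]].
    have i_n : (i < n)%N.
      by rewrite ltnNge; apply/negP => ni; move: h; rewrite nth_default // (leq_trans szn).
    have cn := leq_trans h (lan i).
    have := forallP (ct (Ordinal i_n)) (Ordinal cn); rewrite /= h /=.
    by move/codomP=> [j tj]; exists (nat_of_ord j); rewrite ?ltn_ord // entry_ord /trow /tcol -tj.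
  by rewrite -[j]/(val (Ordinal jn)) entry_ord => -[<- <-]; apply: lt.
apply/eqP; rewrite eqn_leq; apply/andP; split.
  by rewrite leqNgt memE (mem_row_len gt) // ltnn.
by rewrite leqNgt -(mem_row_len gt) // -memE ltnn.
Qed.

(** Standardness supplies the ordinary covers. The row bound and the wrap-around covers come from
    admissibility of the shape just after each entry is placed. *)
Lemma adm_tab_growth k r n la (t : tab n) : (1 < k)%N -> adm_tab k r la t ->
  [/\ growth k (r - k) (entry t) n, is_diagram la
    & forall i, nth 0%N la i = row_len (entry t) n i].
Proof.
move=> k1 /andP[st /forallP ad]; have gt := standard_growth st.
split; last by move=> i; apply: standard_row_len.
  2: by case/and5P: st.
move=> m mn; have [m1 nm pm] := gt _ mn.
have := ad (Ordinal (mn : m.+1 < n.+1)%N) => /=; rewrite sub_shapeE //.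
case/and4P=> _ _ sk; rewrite !(nth_shape gt) ?geq_minr // => cyl.
have rk i : (k <= i)%N -> row_len (entry t) m.+1 i = 0%N.
  move=> ki; rewrite -(nth_shape gt i mn (geq_minr n n)) nth_default //.
  exact: leq_trans ki.
have mT : entry t m \in mkseq (entry t) m.+1 by apply/mem_mkseqP; exists m.
split=> //.
  rewrite ltnNge; apply/negP => /rk h.
  by move: mT; rewrite (surjective_pairing (entry t m)) (mem_row_len gt) // h.
move=> [a1 a2] /or3P[p|p|].
- by apply: pm; rewrite /prec p.
- by apply: pm; rewrite /prec p orbT.
case E: (entry t m) => [i c] /= /and3P[/eqP ek /eqP i0 /eqP ec].
(* Column [a2 + (r - k)] of row 0 is filled, so the bound on the first and last rows forces column
   [a2] of row [k.-1] to be filled. *)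
have : (a1, a2) \in mkseq (entry t) m.+1.
  rewrite (mem_row_len gt) //; move: mT; rewrite E (mem_row_len gt) // i0.
  by move: cyl; rewrite -ek /=; lia.
(* The new box lies in row 0 and differs from a box in row [k.-1] because [1 < k]. *)
case/mem_mkseqP=> j; rewrite ltnS leq_eqVlt => /orP[/eqP->|jm ej]; last by exists j.
by rewrite E => -[]; lia.
Qed.

(** Entries increase because a prefix that contains a box contains all boxes to its left and above
    it; [early] turns this into an inequality of entries. *)
Lemma growth_adm_tab k r n la (t : tab n) : (0 < k)%N ->
  growth k (r - k) (entry t) n -> is_diagram la ->
  (forall i, nth 0%N la i = row_len (entry t) n i) -> adm_tab k r la t.
Proof.
move=> k0 gt dl rl.
have laE : la = shape (entry t) n n.
  apply: is_diagram_ext => // [|i]; first by rewrite (shape_diagram gt) ?geq_minr.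
  by rewrite rl (nth_shape gt) ?geq_minr.
have memo (o : 'I_n) m : (o < m)%N -> (trow t o, tcol t o) \in mkseq (entry t) m.
  by move=> om; rewrite -entry_ord; apply/mem_mkseqP; exists (val o).
have early (o o' : 'I_n) : (trow t o, tcol t o) \in mkseq (entry t) o'.+1 -> (o <= o')%N.
  case/mem_mkseqP=> j jo; rewrite -entry_ord => /(growth_inj gt).
  by move=> e; rewrite -e // (leq_trans jo).
apply/andP; split; last first.
  apply/forallP => j; have jn : (j <= n)%N by rewrite -ltnS.
  by rewrite sub_shapeE // (in_Lambda_shape gt) ?geq_minr.
apply/and5P; split=> //.
- by rewrite laE (sumn_growth_shape gt) ?geq_minr.
- apply/injectiveP => o o' e; apply: val_inj; apply: (growth_inj gt (ltn_ord o) (ltn_ord o')).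
  by rewrite !entry_ord /trow /tcol e.
- by apply/forallP => o; rewrite rl -(mem_row_len gt) // memo.
apply/and3P; split.
- apply/forallP => a; apply/forallP => b; apply/implyP.
  rewrite rl -(mem_row_len gt) // => /mem_mkseqP[j jn].
  have -> : j = Ordinal jn by []; rewrite entry_ord => -[e1 e2].
  apply/codomP; exists (Ordinal jn); move: e1 e2; rewrite /trow /tcol.
  by case: (t _) => x y /= /val_inj -> /val_inj ->.
- apply/forallP => o; apply/forallP => o'; apply/implyP => /andP[/eqP e1 e2].
  rewrite ltn_neqAle; apply/andP; split.
    by apply: contraTneq e2 => /val_inj ->; rewrite ltnn.
  apply: early; have := memo o' o'.+1 (ltnSn _); rewrite !(mem_row_len gt) // e1.
  exact: ltn_trans.
- apply/forallP => o; apply/forallP => o'; apply/implyP => /andP[/eqP e1 e2].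
  rewrite ltn_neqAle; apply/andP; split.
    by apply: contraTneq e2 => /val_inj ->; rewrite ltnn.
  apply: early; have := memo o' o'.+1 (ltnSn _); rewrite !(mem_row_len gt) // e1.
  by move=> h; apply: leq_trans h _; apply: (row_len_mono gt) => //; apply: ltnW.
Qed.

Lemma growth_ext k l n T T' : (forall m, (m < n)%N -> T m = T' m) ->
  growth k l T n -> growth k l T' n.
Proof.
move=> e gT m mn; have [h1 h2 h3] := gT _ mn; rewrite -e //; split=> //.
  by move=> j jm; rewrite -e; [apply: h2|apply: ltn_trans mn].
by move=> a /h3[j jm <-]; exists j; rewrite ?e //; apply: ltn_trans mn.
Qed.

Lemma eq_mkseq_lt (T T' : nat -> nat * nat) n :
  (forall m, (m < n)%N -> T m = T' m) -> mkseq T n = mkseq T' n.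
Proof. by move=> e; apply/eq_in_map => m; rewrite mem_iota => /e. Qed.

Lemma eq_row_len (T T' : nat -> nat * nat) n i :
  (forall m, (m < n)%N -> T m = T' m) -> row_len T n i = row_len T' n i.
Proof. by move=> /eq_mkseq_lt e; rewrite /row_len e. Qed.

(** For a growth sequence the defaults of [insubd] never occur, by [growth_bound]. *)
Definition tab_of n (T : nat -> nat * nat) : tab n :=
  [ffun m : 'I_n => (insubd m (T m).1, insubd m (T m).2)].

Lemma entry_tab_of k l n T m : growth k l T n -> (m < n)%N ->
  entry (tab_of n T) m = T m.
Proof.
move=> gT mn; rewrite -[m]/(val (Ordinal mn)) entry_ord /trow /tcol ffunE /=.
have [h1 h2] := growth_bound gT mn.
by rewrite !val_insubd !(leq_ltn_trans _ mn) //; case: (T m).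
Qed.

Lemma adm_tab_of k r n la T : (0 < k)%N -> growth k (r - k) T n ->
  is_diagram la -> (forall i, nth 0%N la i = row_len T n i) ->
  adm_tab k r la (tab_of n T).
Proof.
move=> k0 gT dl rl; have e m : (m < n)%N -> T m = entry (tab_of n T) m.
  by move=> mn; rewrite (entry_tab_of gT).
apply: growth_adm_tab => // [|i]; first exact: growth_ext e gT.
by rewrite rl; apply: eq_row_len.
Qed.

Lemma entry_sw n (t : tab n) m j : (m.+1 < n)%N -> (j < n)%N ->
  entry (sw m.+1 t) j = swapT m (entry t) j.
Proof.
move=> mn jn; pose o := swap_ix m.+1 (Ordinal jn).
have -> : entry (sw m.+1 t) j = entry t (val o).
  by rewrite -[j]/(val (Ordinal jn)) !entry_ord /trow /tcol ffunE.
rewrite /o /swap_ix val_insubd /= /swapT.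
by case: eqP => _; [|case: eqP => _]; rewrite ?mn ?(ltnW mn) ?jn.
Qed.

Lemma swapTK m T j : swapT m (swapT m T) j = T j.
Proof.
rewrite /swapT !eqxx; case: (eqVneq j m) => [->|_]; first by rewrite ifF //; lia.
by case: eqVneq => [->|_].
Qed.

Lemma swK n m : (m.+1 < n)%N -> involutive (@sw n m.+1).
Proof.
move=> mn t; apply: entry_inj; apply: eq_mkseq_lt => j jn.
rewrite entry_sw // -[RHS](swapTK m) /swapT.
have e x : (x < n)%N -> entry (sw m.+1 t) x = swapT m (entry t) x.
  exact: entry_sw.
by rewrite !e // ltnW.
Qed.

(** The swapped sequence still grows and has the same boxes, hence the same shape. *)
Lemma adm_tab_sw k r n la (t : tab n) m : (1 < k)%N -> (m.+1 < n)%N ->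
  adm_tab k r la t -> ~~ prec k (r - k) (entry t m) (entry t m.+1) ->
  adm_tab k r la (sw m.+1 t).
Proof.
move=> k1 mn /(adm_tab_growth k1)[gt dl rl] np.
have gs := growth_swap gt mn np.
have gs' : growth k (r - k) (entry (sw m.+1 t)) n.
  by apply: growth_ext gs => j jn; rewrite entry_sw.
apply: growth_adm_tab => // [|i]; first exact: ltnW.
rewrite rl; apply: (row_len_eq_growth gt gs') => // b.
have e j : (j < n)%N -> entry (sw m.+1 t) j = swapT m (entry t) j.
  exact: entry_sw.
apply/mem_mkseqP/mem_mkseqP => -[j jn <-].
  exists (if j == m then m.+1 else if j == m.+1 then m else j).
    by case: eqP => _ //; case: eqP => _ //; apply: ltnW.
  rewrite e; last by case: eqP => _ //; case: eqP => _ //; apply: ltnW.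
  rewrite -[RHS](swapTK m) /swapT.
  by case: (eqVneq j m) => [_|jm] //; case: (eqVneq j m.+1) => [_|jm1] //;
     rewrite ?eqxx // (negbTE jm) (negbTE jm1).
exists (if j == m then m.+1 else if j == m.+1 then m else j).
  by case: eqP => _ //; case: eqP => _ //; apply: ltnW.
rewrite e // /swapT.
by case: eqP => // _; case: eqP.
Qed.

(** * The [r]-conjugate of diagrams and tableaux *)

Lemma divn_conj_step N l j : (j < l)%N ->
  ((N.+1 + l - j.+1) %/ l = (N + l - j.+1) %/ l + (N %% l == j))%N.
Proof.
move=> jl; have l0 : (0 < l)%N by apply: leq_ltn_trans jl.
have -> : (N.+1 + l - j.+1 = (N + l - j.+1).+1)%N by lia.
rewrite divnS // addnC; congr (_ + nat_of_bool _)%N.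
have yl := ltn_pmod N l0.
have -> : (N + l - j.+1).+1 = (N %/ l * l + (N %% l + l - j))%N.
  by have := divn_eq N l; lia.
rewrite dvdn_addr ?dvdn_mull //; move: (N %% l)%N yl => y yl.
case: (ltngtP y j) => h.
- by apply: gtnNdvd; lia.
- have -> : (y + l - j = l + (y - j))%N by lia.
  by rewrite dvdn_addr //; apply: gtnNdvd; lia.
- by rewrite h addKn dvdnn.
Qed.

(** The sum is a column sum of the tile. A box added to a row of length [N] raises exactly the tile
    entry in column [N %% l], and [conj_box] sends that box to row [N %% l]. *)
Lemma row_len_conj k l n T m j : growth k l T n -> (m <= n)%N -> (j < l)%N ->
  row_len (conj_box k l \o T) m j =
    (\sum_(i < k) ((row_len T m i + l - j.+1) %/ l))%N.
Proof.
move=> gT + jl; elim: m => [|m IH] mn.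
  by rewrite big1 // => i _; rewrite divn_small // add0n; lia.
have rS (U : nat -> nat * nat) i :
    row_len U m.+1 i = (row_len U m i + ((U m).1 == i))%N.
  by rewrite /row_len mkseqS -cats1 count_cat /= addn0.
rewrite rS IH; last exact: ltnW.
have [km _ _] := gT _ mn; have cm := growth_col gT mn.
rewrite (bigD1 (Ordinal km)) //= [in RHS](bigD1 (Ordinal km)) //=.
rewrite (rS _ (T m).1) eqxx addn1 divn_conj_step // -cm.
rewrite -!addnA [in RHS](addnC (_ == _)%N); congr (_ + (_ + _))%N.
apply: eq_bigr => i; rewrite -val_eqE /= => /negbTE h.
by rewrite rS eq_sym h addn0.
Qed.

Lemma r_conjE k r n la T : growth k (r - k) T n ->
  (forall i, nth 0%N la i = row_len T n i) ->
  r_conj k r la = shape (conj_box k (r - k) \o T) n (r - k).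
Proof.
move=> gT rl; congr filter; apply/eq_in_map => j; rewrite mem_iota => /andP[_ jl].
by rewrite (row_len_conj gT) //; apply: eq_bigr => i _; rewrite rl.
Qed.

Definition conj_tab k l n (t : tab n) : tab n :=
  tab_of n (conj_box k l \o entry t).

Section Conjugate.
Variables (k r n : nat).
Hypotheses (k1 : (1 < k)%N) (kr : (k < r)%N).
Let l := (r - k)%N.
Let l0 : (0 < l)%N. Proof. by rewrite subn_gt0. Qed.
Let rl : (r - l = k)%N. Proof. by rewrite subKn // ltnW. Qed.

Lemma entry_conj_tab la (t : tab n) m : adm_tab k r la t -> (m < n)%N ->
  entry (conj_tab k l t) m = conj_box k l (entry t m).
Proof.
move=> /(adm_tab_growth k1)[gt _ _] mn.
by rewrite (entry_tab_of (growth_conj l0 gt)).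
Qed.

Lemma adm_conj_tab la (t : tab n) : adm_tab k r la t ->
  adm_tab l r (r_conj k r la) (conj_tab k l t).
Proof.
move=> /(adm_tab_growth k1)[gt dl lE]; have gc := growth_conj l0 gt.
rewrite (r_conjE gt lE); apply: adm_tab_of; rewrite ?rl //.
  exact: (shape_diagram gc) (leqnn n) (geq_minl _ _).
by move=> i; rewrite (nth_shape gc) // geq_minl.
Qed.

Lemma in_Lambda_r_conj la (t : tab n) : adm_tab k r la t ->
  in_Lambda l r n (r_conj k r la).
Proof.
move=> /(adm_tab_growth k1)[gt dl lE]; rewrite (r_conjE gt lE).
by apply: (in_Lambda_shape (growth_conj l0 gt)); rewrite ?rl ?geq_minl.
Qed.

End Conjugate.

Lemma conj_tabK k r n la (t : tab n) : (1 < k)%N -> (k < r.-1)%N ->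
  adm_tab k r la t -> conj_tab (r - k) k (conj_tab k (r - k) t) = t.
Proof.
move=> k1 kr at_; have kr' : (k < r)%N by lia.
have rk : (r - (r - k) = k)%N by rewrite subKn // ltnW.
have ac := adm_conj_tab k1 kr' at_.
apply: entry_inj; apply: eq_mkseq_lt => m mn.
rewrite -[X in conj_tab _ X]rk (entry_conj_tab _ _ ac) //; [|lia|lia].
rewrite (entry_conj_tab _ _ at_) // rk conj_boxK //; first by lia.
by have [/(_ _ mn)[]] := adm_tab_growth k1 at_.
Qed.

(** Read off a tableau: conjugating [t] twice returns [t], which is then admissible for both
    diagrams. *)
Lemma r_conjK k r n la (t : tab n) : (1 < k)%N -> (k < r.-1)%N ->
  adm_tab k r la t -> r_conj (r - k) r (r_conj k r la) = la.
Proof.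
move=> k1 kr at_; have kr' : (k < r)%N by lia.
have rk : (r - (r - k) = k)%N by rewrite subKn // ltnW.
have ac := adm_conj_tab k1 kr' at_.
have h1 : (1 < r - k)%N by lia.
have h2 : (r - k < r)%N by lia.
have := adm_conj_tab h1 h2 ac; rewrite rk (conj_tabK k1 kr at_) => a2.
have [_ d1 e1] := adm_tab_growth k1 at_; have [_ d2 e2] := adm_tab_growth k1 a2.
by apply: is_diagram_ext => // i; rewrite e1 e2.
Qed.

(** If [k1] and [k2] differ, the diagram has an empty last row for the larger of them. Its first row
    is then at most [r - maxn k1 k2], too short for any wrap-around cover on either cylinder. *)
Lemma adm_tab_indep k1 k2 r n la (t : tab n) : (1 < k1)%N -> (1 < k2)%N ->
  (k1 < r)%N -> (k2 < r)%N ->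
  in_Lambda k1 r n la -> in_Lambda k2 r n la -> adm_tab k1 r la t ->
  adm_tab k2 r la t.
Proof.
move=> k11 k21 k1r k2r /and4P[dl _ s1 c1] /and4P[_ _ s2 c2] at_.
case: (eqVneq k1 k2) => [<-//|ne].
have [gt _ lE] := adm_tab_growth k11 at_.
apply: growth_adm_tab => //; first exact: ltnW.
have la0 : (nth 0%N la 0 <= r - maxn k1 k2)%N.
  case: (ltngtP k1 k2) ne => // h _.
    by move: c2; rewrite (@nth_default _ _ _ k2.-1); lia.
  by move: c1; rewrite (@nth_default _ _ _ k1.-1); lia.
move=> m mn; have [h1 h2 h3] := gt _ mn.
have memm : ((entry t m).2 < nth 0%N la (entry t m).1)%N.
  rewrite lE -(mem_row_len gt) // -surjective_pairing.
  by apply/mem_mkseqP; exists m.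
split=> //.
  rewrite ltnNge; apply/negP => h.
  by move: memm; rewrite nth_default //; lia.
move=> a /or3P[p|p|/and3P[_ /eqP e1 /eqP e2]].
- by apply: h3; rewrite /prec p.
- by apply: h3; rewrite /prec p orbT.
by move: memm; rewrite e1 -e2; lia.
Qed.

(** * Existence of admissible tableaux with a prescribed second box *)

Definition boxes (k : nat) (la : seq nat) : seq (nat * nat) :=
  [seq (i, c) | i <- iota 0 k, c <- iota 0 (nth 0%N la i)].

Lemma mem_boxes k la i c : (size la <= k)%N ->
  ((i, c) \in boxes k la) = (c < nth 0%N la i)%N.
Proof.
move=> sk; apply/allpairsPdep/idP => [[i' [c' [_ + [-> ->]]]]|h].
  by rewrite mem_iota.
exists i, c; split=> //; rewrite mem_iota // add0n /=.
rewrite (leq_trans _ sk) // ltnNge; apply/negP => s.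
by rewrite nth_default in h.
Qed.

Lemma boxes_uniq k la : uniq (boxes k la).
Proof.
apply: allpairs_uniq_dep => [|i _|[i c] [i' c'] _ _ /= [-> ->]] //; exact: iota_uniq.
Qed.

(* The number [c * k + i * l] strictly increases along [prec], so sorting the
   boxes by it, after forcing [b1] into second place, is a linear extension. *)
Lemma exists_adm_tab k r n la b1 : (1 < k < r.-1)%N -> in_Lambda k r n la ->
  (b1 == (0, 1)%N) || (b1 == (1, 0)%N) -> (b1.2 < nth 0%N la b1.1)%N ->
  exists2 t : tab n, adm_tab k r la t & entry t 1 = b1.
Proof.
move=> /andP[k1 kr] /and4P[dl /eqP sl sk cyl] b1E b1la.
pose l := (r - k)%N; have l1 : (1 < l)%N by rewrite /l; lia.
have {}b1E : b1 = (0, 1)%N \/ b1 = (1, 0)%N.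
  by case/orP: b1E => /eqP; [left|right].
(* The offset 2 places every other box after the corner and [b1]. *)
pose key (b : nat * nat) : nat := if b == (0, 0)%N then 0%N else
  if b == b1 then 1%N else (2 + b.2 * k + b.1 * l)%N.
have k00 : key (0, 0)%N = 0%N by rewrite /key eqxx.
have kb1 : key b1 = 1%N by rewrite /key eqxx ifF //; case: b1E => ->.
have key_prec a b : prec k l a b -> (b.1 < k)%N -> (key a < key b)%N.
  move=> p bk; rewrite {2}/key; case: eqP => [e|nb0].
    by move: p; rewrite e /prec /=; lia.
  case: eqP => [e|nb1].
    (* The corner is the only predecessor of [b1]; a wrap-around predecessor of [(0, 1)] is excluded
       by [1 < l]. *)
    suff -> : a = (0, 0)%N by rewrite k00.
    move: p; rewrite e; case: (a) => x y.
    by case: b1E => ->; rewrite /prec /= => h; congr pair; lia.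
  suff h : (a.2 * k + a.1 * l < b.2 * k + b.1 * l)%N.
    by rewrite /key; case: eqP => [_|_]; [lia|case: eqP => _; lia].
  move: p; case: (a) (b) => [x y] [z w] /or3P[] /=.
  - by case/andP=> /eqP-> /eqP<-; rewrite mulSn; lia.
  - by case/andP=> /eqP<- /eqP->; rewrite mulSn; lia.
  (* Wrapping around replaces [(k - 1) * l] by [l * k], a gain of [l]. *)
  - by case/and3P=> /eqP<- /eqP-> /eqP<-; nia.
have key1 b : (key b <= 1)%N -> b = (0, 0)%N \/ b = b1.
  rewrite /key; case: eqP => [->|_]; first by left.
  by case: eqP => [->|_]; [right|lia].
pose s := sort (fun a b => key a <= key b)%N (boxes k la).
have mems i c : ((i, c) \in s) = (c < nth 0%N la i)%N.
  by rewrite mem_sort mem_boxes.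
have us : uniq s by rewrite sort_uniq boxes_uniq.
have leT : transitive (fun a b => key a <= key b)%N by move=> ? ? ?; apply: leq_trans.
have ss : sorted (fun a b => key a <= key b)%N s.
  by apply: sort_sorted => a b; apply: leq_total.
have le_nth i j : (i <= j)%N -> (j < size s)%N ->
    (key (nth (0, 0)%N s i) <= key (nth (0, 0)%N s j))%N.
  move=> ij js; apply: (sorted_leq_nth leT _ _ ss) => //.
  by rewrite inE (leq_ltn_trans ij).
pose T := nth (0, 0)%N s.
have rowk m : (m < size s)%N -> ((T m).1 < k)%N.
  move=> ms; have := mem_nth (0, 0)%N ms; rewrite -/(T m).
  rewrite (surjective_pairing (T m)) mems /= => h.
  by rewrite ltnNge; apply/negP => kT; move: h; rewrite nth_default //; lia.
have gT : growth k l T (size s).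
  move=> m ms; split; first exact: rowk.
    move=> j jm e; have := nth_uniq (0, 0)%N (ltn_trans jm ms) ms us.
    by rewrite -/(T j) -/(T m) e eqxx => /esym/eqP e'; move: jm; rewrite e' ltnn.
  move=> a pa.
  have as_ : a \in s.
    have := mem_nth (0, 0)%N ms; rewrite -/(T m).
    case: (a) (T m) pa => [x y] [z w] /or3P[] /=; rewrite !mems.
    - by case/andP=> /eqP-> /eqP<-; apply: ltnW.
    - case/andP=> /eqP<- /eqP->; have := is_diagram_noninc x dl; lia.
    - case/and3P=> /eqP ex /eqP-> /eqP<-.
      by move: cyl; rewrite -ex /= -/l /l -ex; lia.
  have ind : (index a s < size s)%N by rewrite index_mem.
  exists (index a s); last by rewrite /T nth_index.
  rewrite ltnNge; apply/negP => h; have := le_nth _ _ h ind.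
  by rewrite nth_index // -/(T m) leqNgt key_prec // rowk.
have rlT i : nth 0%N la i = row_len T (size s) i.
  have e c : (c < nth 0%N la i)%N = (c < row_len T (size s) i)%N.
    by rewrite -(mem_row_len gT) // mkseq_nth mems.
  apply/eqP; rewrite eqn_leq; apply/andP; split.
    by rewrite leqNgt e ltnn.
  by rewrite leqNgt -e ltnn.
have ns : size s = n.
  rewrite -sl -[LHS](sumn_growth_shape gT (leqnn _) (geq_minl _ _)).
  congr sumn; apply: is_diagram_ext => // [|i].
    exact: (shape_diagram gT (leqnn _) (geq_minl _ _)).
  by rewrite (nth_shape gT) ?geq_minl.
have T0 m : (m < size s)%N -> T m = (0, 0)%N -> m = 0%N.
  move=> ms e.
  have s0 : (0 < size s)%N by apply: leq_ltn_trans ms.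
  apply: (growth_inj gT) => //; rewrite e.
  have [] := growth_bound gT s0; case: (T 0%N) => [x y] /=.
  by rewrite !leqn0 => /eqP-> /eqP->.
have [j js Tj] : exists2 j, (j < size s)%N & T j = b1.
  have h : b1 \in s by rewrite (surjective_pairing b1) mems.
  by exists (index b1 s); rewrite ?index_mem // /T nth_index.
have b10 : b1 <> (0, 0)%N by case: b1E => ->.
have j0 : (0 < j)%N.
  rewrite lt0n; apply: contra_notN b10 => /eqP j0; rewrite -Tj j0.
  have s0 : (0 < size s)%N by apply: leq_ltn_trans js.
  have [] := growth_bound gT s0; case: (T 0%N) => [x y] /=.
  by rewrite !leqn0 => /eqP-> /eqP->.
have s1 : (1 < size s)%N by apply: leq_ltn_trans js.
(* The box at position 1 has key at most that of [b1], so it is the corner or [b1], and the corner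
   sits at position 0. *)
have T1 : T 1%N = b1.
  have := le_nth _ _ j0 js; rewrite -/(T j) Tj kb1 => /key1[|//].
  by move/(T0 _ s1).
rewrite ns in gT rlT s1; exists (tab_of n T).
  by apply: adm_tab_of => //; apply: ltnW.
by rewrite (entry_tab_of gT).
Qed.

(** * Roots of unity *)

(** Here [w] is the square root of [q], [u] is [w ^ d], and [y] and [y * u ^+ 2] are the powers of
    [q] at the contents of two consecutive entries. The quotient of quantum integers becomes
    rational in these powers. *)
Lemma alpha_identity (F : fieldType) (w u y : F) :
  w != 0 -> u != 0 -> y != 0 -> w ^+ 2 - 1 != 0 -> 1 + w ^+ 2 != 0 ->
  u ^+ 2 - 1 != 0 ->
  (u * w - u^-1 / w) / (w - w^-1)
    / ((w ^+ 2 - w ^- 2) / (w - w^-1) * ((u - u^-1) / (w - w^-1)))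
  = (w ^+ 2 * (y * u ^+ 2) - y) / ((1 + w ^+ 2) * (y * u ^+ 2 - y)).
Proof.
move=> w0 u0 y0 w1 w2 u1.
have -> : w - w^-1 = (w ^+ 2 - 1) / w by field.
have -> : w ^+ 2 - w ^- 2 = (w ^+ 2 - 1) * (1 + w ^+ 2) / w ^+ 2 by field.
have -> : u - u^-1 = (u ^+ 2 - 1) / u by field.
have -> : y * u ^+ 2 - y = y * (u ^+ 2 - 1) by ring.
by field; rewrite ?w0 ?u0 ?y0 ?w1 ?w2 ?u1.
Qed.

Section RootOfUnity.
Variables (R : realType) (sgn : bool) (r : nat).
Hypothesis r4 : (4 < r)%N.
Local Notation C := R[i].
Local Notation w := (qhalf R sgn r).
Local Notation q := (qq R sgn r).

Lemma qhalfX m : w ^+ m =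
  Complex (cos (m%:R * (pi / r%:R)))
          ((if sgn then 1 else -1) * sin (m%:R * (pi / r%:R))).
Proof.
have w1 : w = Complex (cos (pi / r%:R)) ((if sgn then 1 else -1) * sin (pi / r%:R)).
  rewrite /qhalf -complexiE; apply/eqP; rewrite eq_complex /=.
  by rewrite !mul0r !mul1r ?subr0 ?addr0 ?add0r !eqxx.
elim: m => [|m IH].
  by rewrite expr0 mul0r cos0 sin0 mulr0; apply/eqP; rewrite eq_complex /= !eqxx.
have -> : m.+1%:R * (pi / r%:R) = pi / r%:R + m%:R * (pi / r%:R) :> R.
  by rewrite -nat1r mulrDl mul1r.
rewrite exprS IH w1 cosD sinD; apply/eqP; rewrite eq_complex /=.
apply/andP; split; apply/eqP; case: sgn => /=; ring.
Qed.

Let pir : r%:R * (pi / r%:R) = pi :> R.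
Proof. by rewrite mulrC divfK // pnatr_eq0; lia. Qed.

Lemma qhalf_neq0 : w != 0.
Proof.
apply/eqP => w0; have := qhalfX r.
rewrite w0 expr0n pir cospi sinpi mulr0 gtn_eqF; last by lia.
by case=> /eqP; rewrite eq_sym oppr_eq0 oner_eq0.
Qed.

Lemma qq_neq0 : q != 0.
Proof. by rewrite expf_neq0 // qhalf_neq0. Qed.

Lemma qqXr : q ^+ r = 1.
Proof.
rewrite /qq -exprM mulnC exprM qhalfX pir cospi sinpi mulr0.
by apply/eqP; rewrite eq_complex /=; apply/andP; split; apply/eqP; ring.
Qed.

(** Otherwise [w ^+ m] would be 1 or -1, but its imaginary part is, up to sign, the sine of an angle
    strictly between 0 and [pi]. *)
Lemma qqX_neq1 m : (0 < m < r)%N -> q ^+ m != 1.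
Proof.
move=> /andP[m0 mr]; rewrite /qq exprAC -subr_eq0 -[1](expr1n _ 2) subr_sqr.
have : complex.Im (w ^+ m) != 0.
  rewrite qhalfX /= mulf_neq0 //; first by case: sgn; rewrite ?oppr_eq0 oner_eq0.
  apply/lt0r_neq0/sin_gt0_pi.
  have r0 : 0 < r%:R :> R by rewrite ltr0n; lia.
  rewrite mulr_gt0 ?ltr0n ?divr_gt0 ?pi_gt0 //=.
  by rewrite mulrCA gtr_pMr ?pi_gt0 // ltr_pdivrMr // mul1r ltr_nat.
case: (w ^+ m) => x y /= y0; rewrite mulf_neq0 // eq_complex /=.
  by rewrite subr0 (negbTE y0) andbF.
by rewrite addr0 (negbTE y0) andbF.
Qed.

(** Since [q] is a primitive [r]-th root of unity, equality of Jucys-Murphy eigenvalues means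
    congruence of contents. *)
Lemma qqz_eq1 (z : int) : (q ^ z == 1) = (r %| z)%Z.
Proof.
have r0 : r%:Z != 0 by rewrite -lt0n; lia.
have -> : q ^ z = q ^ (z %% r)%Z.
  rewrite {1}(divz_eq z r) expfzDr ?qq_neq0 // mulrC [_ * r%:Z]mulrC -exprz_exp.
  by rewrite -exprnP qqXr exp1rz mulr1.
have -> : (r %| z)%Z = ((z %% r)%Z == 0) by apply/dvdz_mod0P/eqP.
have := modz_ge0 z r0; have := @ltz_pmod z r%:Z.
case: (z %% r)%Z => // m /= mr _; rewrite -exprnP.
have {}mr : (m < r)%N by have := mr; lia.
case: m mr => [|m] mr; first by rewrite expr0 !eqxx.
by rewrite (negbTE (qqX_neq1 _)).
Qed.

Lemma qq_neq1 : q != 1.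
Proof. by rewrite -[q]expr1 qqX_neq1 //; lia. Qed.

Lemma qq2_neq1 : q ^+ 2 != 1.
Proof. by rewrite qqX_neq1 //; lia. Qed.

Lemma qq1_neq0 : 1 + q != 0.
Proof.
apply: contra qq2_neq1; rewrite addrC addr_eq0 => /eqP->.
by rewrite sqrrN expr1n.
Qed.

(** The eigenvalue at [v_t] of the Jucys-Murphy matrix of entry [m.+1], the index being
    zero-based. *)
Definition jm n (t : tab n) (m : nat) : C := q ^ content (entry t m).

Lemma jm_neq0 n (t : tab n) m : jm t m != 0.
Proof. exact/expfz_neq0/qq_neq0. Qed.

Lemma jm_eq n n' (t : tab n) (t' : tab n') m m' :
  (jm t m == jm t' m') = (r %| content (entry t m) - content (entry t' m'))%Z.
Proof.
rewrite -qqz_eq1 expfzDr ?qq_neq0 // -invr_expz.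
by rewrite -(inj_eq (mulIf (invr_neq0 (jm_neq0 t' m')))) divff ?jm_neq0.
Qed.

(** The number [alpha] freed of the square root of [q]: it depends on contents only modulo [r]. *)
Definition alpha_of (x y : C) : C := (q * x - y) / ((1 + q) * (x - y)).

Lemma alphaE n (t : tab n) m : jm t m != jm t m.+1 ->
  alpha R sgn r n t m.+1 = alpha_of (jm t m) (jm t m.+1).
Proof.
move=> xy; rewrite /alpha.
have -> : dd t m.+1 = content (entry t m) - content (entry t m.+1).
  by rewrite /dd /content /entry; lia.
set d := content _ - content _; have w0 := qhalf_neq0.
have xE : jm t m = jm t m.+1 * (w ^ d) ^+ 2.
  rewrite {1}/jm -[content (entry t m)](subrK (content (entry t m.+1))) -/d.
  rewrite expfzDr ?qq_neq0 // mulrC; congr (_ * _).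
  by rewrite /qq !exprnP !exprz_exp mulrC.
clearbody d; have u0 : w ^ d != 0 by apply: expfz_neq0.
rewrite /alpha_of /qint -[2 : int]/(Posz 2) !opprD !expfzDr // -!invr_expz.
rewrite !expr1z -!exprnP xE.
apply: alpha_identity => //; rewrite ?jm_neq0 ?subr_eq0 ?qq_neq1 ?qq1_neq0 //.
by apply: contra xy; rewrite xE => /eqP->; rewrite mulr1.
Qed.

End RootOfUnity.

(** * Matrices of the sectors *)

Section Pmx.
Variable F : fieldType.

(** Bases are enumerations of predicates; this form allows matrix computations to be carried out on
    tableaux instead of ordinals. *)
Definition pmx (A B : finType) (P : pred A) (Q : pred B) (f : A -> B -> F) :
  'M[F]_(#|P|, #|Q|) := \matrix_(a, b) f (enum_val a) (enum_val b).

Lemma eq_pmx (A B : finType) (P : pred A) (Q : pred B) (f g : A -> B -> F) :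
  (forall x y, P x -> Q y -> f x y = g x y) -> pmx P Q f = pmx P Q g.
Proof. by move=> e; apply/matrixP => a b; rewrite !mxE e //; apply: enum_valP. Qed.

Lemma mul_pmx (A B D : finType) (P : pred A) (Q : pred B) (S : pred D)
    (f : A -> B -> F) (g : B -> D -> F) :
  pmx P Q f *m pmx Q S g = pmx P S (fun x z => \sum_(y in Q) f x y * g y z).
Proof.
apply/matrixP => a b; rewrite !mxE [RHS]big_enum_val.
by apply: eq_bigr => c _; rewrite !mxE.
Qed.

Lemma pmx1 (A : finType) (P : pred A) : pmx P P (fun x y => (x == y)%:R) = 1%:M.
Proof. by apply/matrixP => a b; rewrite !mxE (inj_eq enum_val_inj). Qed.

Lemma sum_pred1 (A : finType) (P : pred A) (t : A) (f : A -> F) : P t ->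
  \sum_(x in P) f x * (x == t)%:R = f t.
Proof.
move=> Pt; rewrite (bigD1 t) //= eqxx mulr1 big1 ?addr0 // => x /andP[_ /negbTE->].
by rewrite mulr0.
Qed.

(** [W] is a bijection of bases rescaled by [e]. It is chosen before [f1] and [f2], so a single [W]
    intertwines all generators. *)
Lemma pmx_transport (A B : finType) (P : pred A) (Q : pred B) (g : B -> A)
    (h : A -> B) (e : B -> F) :
  (forall y, Q y -> P (g y)) -> (forall x, P x -> Q (h x)) ->
  (forall y, Q y -> h (g y) = y) -> (forall x, P x -> g (h x) = x) ->
  (forall y, Q y -> e y != 0) ->
  exists W : 'M[F]_(#|P|, #|Q|), [/\ row_free W, row_full W &
    forall f1 f2, (forall y z, Q y -> Q z -> f1 (g y) (g z) * e z = e y * f2 y z) ->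
    pmx P P f1 *m W = W *m pmx Q Q f2].
Proof.
move=> QP PQ hg gh e0.
pose W := pmx P Q (fun x y => e y * (x == g y)%:R).
pose W' := pmx Q P (fun y x => (e y)^-1 * (x == g y)%:R).
have geq x y : P x -> Q y -> (x == g y) = (y == h x).
  by move=> Px Qy; apply/eqP/eqP => ->; rewrite ?hg ?gh.
exists W; split.
- apply/row_freeP; exists W'; rewrite mul_pmx -pmx1; apply: eq_pmx => x x' Px Px'.
  rewrite (eq_bigr (fun y => (e y / e y * (x' == g y)%:R) * (y == h x)%:R)).
    rewrite sum_pred1 ?PQ // gh // divff ?e0 ?PQ // mul1r.
    by rewrite eq_sym.
  by move=> y Qy; rewrite -geq //; ring.
- apply/row_fullP; exists W'; rewrite mul_pmx -pmx1; apply: eq_pmx => y y' Qy Qy'.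
  rewrite (eq_bigr (fun x => ((e y)^-1 * e y' * (x == g y)%:R) * (x == g y')%:R)).
    rewrite sum_pred1 ?QP // geq ?QP // hg //.
    by case: eqP => [->|_]; rewrite ?mulr1 ?mulr0 // mulVf // e0.
  by move=> x Px; ring.
move=> f1 f2 ff; rewrite !mul_pmx; apply: eq_pmx => x y Px Qy.
rewrite (eq_bigr (fun z => f1 x z * e y * (z == g y)%:R)); last by move=> *; ring.
rewrite sum_pred1 ?QP //.
rewrite [RHS](eq_bigr (fun z => e z * f2 z y * (z == h x)%:R)).
  by rewrite sum_pred1 ?PQ // -ff ?PQ // gh.
by move=> z Qz; rewrite geq //; ring.
Qed.

End Pmx.

Section AlphaOf.
Variables (R : realType) (sgn : bool) (r : nat).
Hypothesis r4 : (4 < r)%N.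
Local Notation q := (qq R sgn r).
Local Notation alf := (alpha_of sgn r).

Lemma alpha_ofC (x y : R[i]) : x != y -> alf y x = 1 - alf x y.
Proof.
move=> xy; have q1 := qq1_neq0 R sgn r4; rewrite /alpha_of.
have e1 : x - y != 0 by rewrite subr_eq0.
have e2 : y - x != 0 by rewrite subr_eq0 eq_sym.
by field; rewrite q1 e1 e2.
Qed.

Lemma alpha_ofV (x y : R[i]) : x != 0 -> y != 0 -> x != y ->
  alf x^-1 y^-1 = 1 - alf x y.
Proof.
move=> x0 y0 xy; have q1 := qq1_neq0 R sgn r4; rewrite /alpha_of.
have e1 : x - y != 0 by rewrite subr_eq0.
have -> : x^-1 - y^-1 = - (x - y) / (x * y) by field; rewrite x0 y0.
by field; rewrite q1 e1 x0 y0.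
Qed.

Lemma alpha_of_row (x : R[i]) : alf x (q * x) = 0.
Proof. by rewrite /alpha_of subrr mul0r. Qed.

Lemma alpha_of_col (y : R[i]) : y != 0 -> alf (q * y) y = 1.
Proof.
move=> y0; have q1 := qq1_neq0 R sgn r4; have q2 := qq_neq1 R sgn r4.
rewrite /alpha_of; have e1 : q - 1 != 0 by rewrite subr_eq0.
have -> : q * y - y = (q - 1) * y by ring.
by field; rewrite q1 e1 y0.
Qed.

End AlphaOf.

(** * Projections and Jucys-Murphy matrices of one sector *)

Section Rep.
Variables (R : realType) (sgn : bool) (k r n : nat) (la : seq nat).
Hypotheses (r4 : (4 < r)%N) (k1 : (1 < k)%N) (kr : (k < r.-1)%N).
Local Notation C := R[i].
Local Notation q := (qq R sgn r).
Local Notation X := (jm R sgn r).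
Local Notation al := (alpha R sgn r n).
Local Notation be := (beta R sgn r n).
Local Notation P := (basis k r n la).

Let kE : (k + (r - k) = r)%N. Proof. by rewrite subnKC //; lia. Qed.

Lemma jm0 (t : tab n) : P t -> (0 < n)%N -> X t 0 = 1.
Proof.
move=> /(adm_tab_growth k1)[gt _ _] n0; rewrite /jm.
have [] := growth_bound gt n0; case: (entry t 0) => [a b] /=.
by rewrite !leqn0 => /eqP-> /eqP->; rewrite /content subrr expr0z.
Qed.

Lemma jm_prec (a b : nat * nat) : prec k (r - k) a b ->
  q ^ content b = q * q ^ content a \/ q ^ content a = q * q ^ content b.
Proof.
have q0 := qq_neq0 R sgn r4.
have qS z : q * q ^ z = q ^ (z + 1) by rewrite expfzDr // expr1z mulrC.
move=> /prec_content; rewrite kE => -[] e.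
- by left; rewrite qS; congr (_ ^ _); lia.
- by right; rewrite qS; congr (_ ^ _); lia.
- right; rewrite qS; have -> : content a = content b + 1 - r%:Z by lia.
  by rewrite [RHS]expfzDr // expfzDr // expfzDr // -invr_expz -exprnP qqXr // invr1 mulr1.
Qed.

(** Keeps the denominators of [alpha_of] nonzero. Related boxes give values differing by the factor
    [q]; unrelated ones are separated by [growth_content_step]. *)
Lemma jm_step (t : tab n) m : P t -> (m.+1 < n)%N -> X t m != X t m.+1.
Proof.
move=> /(adm_tab_growth k1)[gt _ _] mn.
have [p|np] := boolP (prec k (r - k) (entry t m) (entry t m.+1)); last first.
  by rewrite jm_eq // -kE; apply: growth_content_step gt mn np.
have q1 := qq_neq1 R sgn r4; have y0 := jm_neq0 R sgn r4.
case: (jm_prec p) => e.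
  have : X t m.+1 = q * X t m by [].
  move=> ->; rewrite eq_sym -subr_eq0 -[X in _ - X]mul1r -mulrBl.
  by rewrite mulf_neq0 ?subr_eq0.
have : X t m = q * X t m.+1 by [].
move=> ->; rewrite -subr_eq0 -[X in _ - X]mul1r -mulrBl.
by rewrite mulf_neq0 ?subr_eq0.
Qed.

Lemma jm_sw (t : tab n) m : (m.+1 < n)%N ->
  X (sw m.+1 t) m = X t m.+1 /\ X (sw m.+1 t) m.+1 = X t m.
Proof.
move=> mn; rewrite /jm !entry_sw // ?(ltnW mn) // /swapT !eqxx.
by rewrite ifF //; lia.
Qed.

Lemma alpha_sw (t : tab n) m : P t -> (m.+1 < n)%N ->
  al (sw m.+1 t) m.+1 = 1 - al t m.+1.
Proof.
move=> Pt mn; have xy := jm_step Pt mn; have [e1 e2] := jm_sw t mn.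
by rewrite !alphaE // ?e1 ?e2 1?eq_sym // alpha_ofC.
Qed.

Lemma beta_sw (t : tab n) m : P t -> (m.+1 < n)%N ->
  be (sw m.+1 t) m.+1 = be t m.+1.
Proof. by move=> Pt mn; rewrite /beta alpha_sw //; congr sqrtC; ring. Qed.

(** When the swap is not admissible, the two boxes form a cover, so [alpha] is 0 or 1. Thus [beta]
    vanishes where the basis is cut off. *)
Lemma alpha_nonadm (t : tab n) m : P t -> (m.+1 < n)%N ->
  ~~ P (sw m.+1 t) -> al t m.+1 * (1 - al t m.+1) = 0.
Proof.
move=> Pt mn nP; rewrite alphaE //; last exact: jm_step.
have p : prec k (r - k) (entry t m) (entry t m.+1).
  by apply: contraR nP => np; apply: adm_tab_sw.
case: (jm_prec p) => e.
  have -> : X t m.+1 = q * X t m by [].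
  by rewrite alpha_of_row mul0r.
have -> : X t m = q * X t m.+1 by [].
by rewrite alpha_of_col ?jm_neq0 // subrr mulr0.
Qed.

Lemma sqr_beta (t : tab n) m : be t m ^+ 2 = al t m * (1 - al t m).
Proof. exact: sqrtCK. Qed.

Lemma sw_neq (t : tab n) m : P t -> (m.+1 < n)%N -> (t == sw m.+1 t) = false.
Proof.
move=> Pt mn; apply/negP => /eqP e; have [+ _] := jm_sw t mn.
by rewrite -e => /eqP; rewrite (negbTE (jm_step Pt mn)).
Qed.

Definition Efun (i : nat) (t' t : tab n) : C :=
  (if t' == t then al t i else 0) + (if t' == sw i t then be t i else 0).

Lemma EmxE i : Emx R sgn k r n la i = pmx P P (Efun i).
Proof. by []. Qed.

Lemma Efun_sym m (t t' : tab n) : P t -> P t' -> (m.+1 < n)%N ->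
  Efun m.+1 t t' = Efun m.+1 t' t.
Proof.
move=> Pt Pt' mn; rewrite /Efun eq_sym; congr (_ + _).
  by case: eqP => // ->.
rewrite -(inj_eq (inv_inj (swK mn))) swK // eq_sym.
by case: eqP => // ->; rewrite beta_sw.
Qed.

Lemma sum_Efun m (t : tab n) (f : tab n -> C) : P t -> (m.+1 < n)%N ->
  \sum_(x in P) f x * Efun m.+1 x t =
  f t * al t m.+1 + (if P (sw m.+1 t) then f (sw m.+1 t) * be t m.+1 else 0).
Proof.
move=> Pt mn.
rewrite (eq_bigr (fun x => f x * al t m.+1 * (x == t)%:R
    + f x * be t m.+1 * (x == sw m.+1 t)%:R)); last first.
  by move=> x _; rewrite /Efun; do 2!case: eqP => _; rewrite /= ?mulr1n ?mulr0n; ring.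
rewrite big_split /= sum_pred1 //; congr (_ + _).
case: ifP => [Ps|nPs]; first by rewrite sum_pred1.
rewrite big1 // => x Px; case: eqP => [e|_]; last by rewrite mulr0.
by move: Px; rewrite e /in_mem /= nPs.
Qed.

(** On [v_t] and its swap the block has diagonal [alpha], [1 - alpha] and off-diagonal [beta], with
    trace 1 and determinant 0. With no admissible swap it is the scalar 0 or 1. *)
Lemma Emx_idem m : (m.+1 < n)%N ->
  Emx R sgn k r n la m.+1 *m Emx R sgn k r n la m.+1 = Emx R sgn k r n la m.+1.
Proof.
move=> mn; rewrite EmxE mul_pmx; apply: eq_pmx => x t Px Pt.
rewrite sum_Efun // /Efun; case: (boolP (P (sw m.+1 t))) => [Ps|nPs].
  rewrite swK // alpha_sw // beta_sw //; have b2 := sqr_beta t m.+1.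
  case: (eqVneq x t) => [->|_]; first rewrite sw_neq //.
    by rewrite !addr0 add0r -!expr2 b2; ring.
  by case: eqP => _; ring.
have b0 : be t m.+1 = 0 by rewrite /beta alpha_nonadm // sqrtC0.
rewrite b0 addr0; case: eqP => [_|_]; last by rewrite !if_same !addr0 mul0r.
have := alpha_nonadm Pt mn nPs; rewrite mulrBr mulr1 => /eqP; rewrite subr_eq0 => /eqP e.
by rewrite !if_same !addr0 -e.
Qed.

Lemma Emx_sym m : (m.+1 < n)%N ->
  (Emx R sgn k r n la m.+1)^T = Emx R sgn k r n la m.+1.
Proof.
move=> mn; apply/matrixP => a b; rewrite EmxE !mxE.
by apply: (Efun_sym _ _ mn); [apply: (enum_valP b)|apply: (enum_valP a)].
Qed.

Definition Dmx (m : nat) : 'M[C]_(dimV k r n la) :=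
  diag_mx (\row_a X (enum_val a : tab n) m).

(** The Jucys-Murphy relation, as the last factor is [B + 1 - q] for [B] the image of the generator.
    Diagonal entries restate the formula for [alpha_of]; off the diagonal, the swap exchanges the
    two eigenvalues. *)
Lemma Dmx_step m : (m.+1 < n)%N ->
  rho R sgn k r n la m.+1 *m Dmx m
  = Dmx m.+1 *m (1%:M - (1 + q) *: Emx R sgn k r n la m.+1).
Proof.
move=> mn; rewrite mul_mx_diag mul_diag_mx; apply/matrixP => a b.
rewrite !mxE -!/(Efun _ _ _) -(inj_eq enum_val_inj).
have := enum_valP a; have := enum_valP b.
move: (enum_val a) (enum_val b) => x t Pt Px; rewrite /Efun.
have q1 := qq1_neq0 R sgn r4.
case: (eqVneq x t) => [->|_]; last case: eqP => [->|_].
- rewrite sw_neq // addr0 alphaE ?jm_step // /alpha_of.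
  have e1 : X t m - X t m.+1 != 0 by rewrite subr_eq0 jm_step.
  by rewrite mulr1n; field; rewrite q1 e1.
- by have [_ ->] := jm_sw t mn; rewrite !mulr0n; ring.
- by rewrite !mulr0n; ring.
Qed.

End Rep.

(** * Equivalence of representations *)

Section Equivalence.
Variable F : fieldType.

Lemma rep_equiv_sym n d1 d2 (rh1 : nat -> 'M[F]_d1) (rh2 : nat -> 'M[F]_d2) :
  rep_equiv n rh1 rh2 -> rep_equiv n rh2 rh1.
Proof.
case=> W [/row_freeP[N WN] /row_fullP[L LW] e].
have LN : L = N by rewrite -[L]mulmx1 -WN mulmxA LW mul1mx.
rewrite {}LN in LW; exists N; split.
- by apply/row_freeP; exists W.
- by apply/row_fullP; exists W.
move=> i /e ei.
by rewrite -[RHS]mulmx1 -WN !mulmxA -(mulmxA N) ei !mulmxA LW mul1mx.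
Qed.

Lemma rep_equiv_trans n d1 d2 d3 (rh1 : nat -> 'M[F]_d1)
    (rh2 : nat -> 'M[F]_d2) (rh3 : nat -> 'M[F]_d3) :
  rep_equiv n rh1 rh2 -> rep_equiv n rh2 rh3 -> rep_equiv n rh1 rh3.
Proof.
case=> W [/row_freeP[N WN] /row_fullP[L LW] e].
case=> W' [/row_freeP[N' WN'] /row_fullP[L' LW'] e'].
exists (W *m W'); split.
- apply/row_freeP; exists (N' *m N).
  by rewrite -mulmxA (mulmxA W') WN' mul1mx.
- apply/row_fullP; exists (L' *m L).
  by rewrite -mulmxA (mulmxA L) LW mul1mx.
by move=> i h; rewrite mulmxA e // -mulmxA e' // mulmxA.
Qed.

Lemma rep_equiv_scale n d1 d2 (rh1 : nat -> 'M[F]_d1) (rh2 : nat -> 'M[F]_d2)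
    (c : nat -> F) :
  rep_equiv n rh1 rh2 -> rep_equiv n (tensor_char c rh1) (tensor_char c rh2).
Proof.
case=> W [f u e]; exists W; split=> // i h.
by rewrite /tensor_char -scalemxAl e // scalemxAr.
Qed.

Lemma eq_rep_equiv n d (rh1 rh2 : nat -> 'M[F]_d) :
  (forall i, (0 < i < n)%N -> rh1 i = rh2 i) -> rep_equiv n rh1 rh2.
Proof.
move=> e; exists 1%:M; split; rewrite ?row_free_unit ?row_full_unit ?unitmx1 //.
by move=> i /e ->; rewrite mulmx1 mul1mx.
Qed.

Lemma affine_intertwine d1 d2 (A : 'M[F]_d1) (B : 'M[F]_d2) W (a b : F) :
  A *m W = W *m B -> (a *: 1%:M - b *: A) *m W = W *m (a *: 1%:M - b *: B).
Proof.
by move=> e; rewrite mulmxBl mulmxBr -!scalemxAl -!scalemxAr e mul1mx mulmx1.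
Qed.

Lemma idem_mul d (E : 'M[F]_d) (a b c e : F) : E *m E = E ->
  (a *: 1%:M - b *: E) *m (c *: 1%:M - e *: E)
  = (a * c) *: 1%:M - (a * e + b * c - b * e) *: E.
Proof.
move=> EE; rewrite mulmxBl !mulmxBr -!scalemxAl -!scalemxAr !mulmx1 !mul1mx EE.
by apply/matrixP => i j; rewrite !mxE; ring.
Qed.

(** For commuting invertible values the braid relation cancels to [psi i = psi i.+1]. *)
Lemma character_const n (psi : nat -> F) i : is_character n psi ->
  (0 < i < n)%N -> psi i = psi 1%N.
Proof.
case=> nz _ br; elim: i => // -[|i] IH // h; rewrite -IH; last by lia.
have := br i.+1 isT; case/andP: (h) => _ -> /(_ isT).
have z1 := nz _ h; have z2 : psi i.+1 != 0 by apply: nz; lia.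
rewrite (mulrC (psi i.+1)) -!mulrA => /(mulfI z1)/(mulfI z2).
by [].
Qed.

End Equivalence.

Lemma injective_adm k r n la (t : tab n) : adm_tab k r la t -> injective t.
Proof. by case/andP=> /and5P[_ _ /injectiveP]. Qed.

(** * An alternating function of tableaux *)

Section Sign.
Variables (F : numFieldType) (n : nat).

(* Any nonvanishing function of tableaux that changes sign under [sw] would do. *)
Definition tab_sign (t : tab n) : F :=
  \det (Vandermonde n (\row_j ((trow t j * n + tcol t j)%N%:R : F))).

(** The swap exchanges two columns of the Vandermonde matrix. *)
Lemma tab_sign_sw m (t : tab n) : (m.+1 < n)%N ->
  tab_sign (sw m.+1 t) = - tab_sign t.
Proof.
move=> mn; pose o1 := Ordinal (ltnW mn); pose o2 := Ordinal mn.
rewrite /tab_sign [X in \det X = _](_ : _ =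
  xcol o1 o2 (Vandermonde n (\row_j ((trow t j * n + tcol t j)%N%:R : F)))).
  rewrite xcolE det_mulmx det_perm odd_tperm.
  by rewrite -val_eqE /= neq_ltn ltnSn expr1 mulrN1.
apply/matrixP => i j; rewrite !mxE; congr (_ ^+ _).
suff e : swap_ix m.+1 j = tperm o1 o2 j by rewrite /trow /tcol ffunE e.
apply: val_inj; rewrite /swap_ix val_insubd /=.
case: tpermP => [->|->|/eqP n1 /eqP n2] /=; rewrite ?eqxx ?mn //.
  by rewrite (gtn_eqF (ltnSn m)) (ltnW mn).
by rewrite -!val_eqE /= in n1 n2; rewrite (negbTE n1) (negbTE n2) ltn_ord.
Qed.

(** Distinct boxes have distinct codes [row * n + column], because columns are below [n]. *)
Lemma tab_sign_neq0 (t : tab n) : injective t -> tab_sign t != 0.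
Proof.
move=> ti; rewrite /tab_sign det_Vandermonde.
apply/prodf_neq0 => i _; apply/prodf_neq0 => j ij; rewrite !mxE subr_eq0 eqr_nat.
apply: contraTN ij => /eqP e; suff -> : j = i by rewrite ltnn.
apply: ti; move: e; rewrite /trow /tcol; case: (t j) (t i) => [a b] [a' b'] /= e.
have [e1 e2] := divn_modn_MD a (ltn_ord b).
have [e1' e2'] := divn_modn_MD a' (ltn_ord b').
rewrite mulnC (mulnC a') in e; rewrite e in e1 e2.
by congr pair; apply: val_inj; rewrite /= -?e1 -?e2 ?e1' ?e2'.
Qed.

End Sign.

(** * Changing [k], and the contragredient of a sector *)

Section RepEquiv.
Variables (R : realType) (sgn : bool) (r n : nat).
Hypothesis r4 : (4 < r)%N.
Local Notation C := R[i].
Local Notation q := (qq R sgn r).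
Local Notation X := (jm R sgn r).
Local Notation rho := (fun k => rho R sgn k r n).
Local Notation Emx := (fun k => Emx R sgn k r n).

(** The two bases consist of the same tableaux, and the entries of the matrices do not involve
    [k]. *)
Lemma rho_indep k1 k2 la : (1 < k1 < r.-1)%N -> (1 < k2 < r.-1)%N ->
  in_Lambda k1 r n la -> in_Lambda k2 r n la ->
  rep_equiv n (rho k1 la) (rho k2 la).
Proof.
move=> /andP[k11 k1r] /andP[k21 k2r] L1 L2.
have k1r' : (k1 < r)%N by lia.
have k2r' : (k2 < r)%N by lia.
have [||||t _|W [f u e]] := @pmx_transport C (tab n) (tab n) (basis k1 r n la)
  (basis k2 r n la) id id (fun _ => 1) => //.
- by move=> t /(adm_tab_indep k21 k11 k2r' k1r' L2 L1).
- by move=> t /(adm_tab_indep k11 k21 k1r' k2r' L1 L2).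
- exact: oner_neq0.
exists W; split=> // i _; apply: affine_intertwine.
by apply: (e (Efun R sgn r i) (Efun R sgn r i)) => y z _ _; rewrite mulr1 mul1r.
Qed.

Lemma jm_conj k la (t : tab n) m : (1 < k < r.-1)%N -> adm_tab k r la t ->
  (m < n)%N -> X (conj_tab k (r - k) t) m = (X t m)^-1.
Proof.
move=> /andP[k1 kr] at_ mn; have kr' : (k < r)%N by lia.
rewrite /jm (entry_conj_tab k1 kr' at_ mn) content_conj_box.
rewrite subnKC; last exact: ltnW.
rewrite expfzDr ?qq_neq0 // -exprz_exp -!exprnP qqXr // expr1n mul1r.
by rewrite invr_expz.
Qed.

Lemma sw_conj k la (t t' : tab n) m : (1 < k < r.-1)%N -> (m.+1 < n)%N ->
  adm_tab k r la t -> adm_tab k r la t' ->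
  (conj_tab k (r - k) t' == sw m.+1 (conj_tab k (r - k) t)) = (t' == sw m.+1 t).
Proof.
move=> /andP[k1 kr] mn at_ at'; have kr' : (k < r)%N by lia.
have l0 : (0 < r - k)%N by lia.
have [gt _ _] := adm_tab_growth k1 at_; have [gt' _ _] := adm_tab_growth k1 at'.
have sE j : (j < n)%N -> entry (sw m.+1 (conj_tab k (r - k) t)) j
    = conj_box k (r - k) (swapT m (entry t) j).
  move=> jn; rewrite entry_sw // /swapT.
  by case: eqP => _; [|case: eqP => _]; rewrite (entry_conj_tab k1 kr' at_) // ltnW.
have rk j : (j < n)%N -> ((swapT m (entry t) j).1 < k)%N.
  move=> jn; have [h0 _ _] := gt _ jn; have [h1 _ _] := gt _ mn.
  have [h2 _ _] := gt _ (ltnW mn).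
  by rewrite /swapT; case: eqP => _ //; case: eqP.
apply/eqP/eqP => e; apply: entry_inj; apply: eq_mkseq_lt => j jn.
  have := congr1 (fun u => conj_box (r - k) k (entry u j)) e.
  rewrite (entry_conj_tab k1 kr' at') // sE // !conj_boxK // ?rk //.
    by move=> ->; rewrite entry_sw.
  by have [h _ _] := gt' _ jn.
by rewrite sE // (entry_conj_tab k1 kr' at') // e entry_sw.
Qed.

(** Conjugation turns [alpha] into [1 - alpha] and keeps [beta], whereas [1 - E] has off-diagonal
    entries [- beta]. Rescaling by [tab_sign] absorbs the sign. *)
Lemma rho_conj k la : (1 < k < r.-1)%N -> (exists t : tab n, adm_tab k r la t) ->
  rep_equiv n (rho (r - k)%N (r_conj k r la))
    (fun i => q *: 1%:M - (1 + q) *: (1%:M - Emx k la i)).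
Proof.
move=> kk [t0 at0]; have /andP[k1 kr] := kk.
have kr' : (k < r)%N by lia.
have rk : (r - (r - k) = k)%N by lia.
have l1 : (1 < r - k)%N by lia.
have lr : (r - k < r.-1)%N by lia.
have cE : r_conj (r - k) r (r_conj k r la) = la by apply: r_conjK at0.
have [||||t at_|W [f u e]] := @pmx_transport C (tab n) (tab n)
    (basis (r - k) r n (r_conj k r la)) (basis k r n la)
    (@conj_tab k (r - k) n) (@conj_tab (r - k) k n) (@tab_sign C n).
- by move=> t /(adm_conj_tab k1 kr').
- move=> t /(adm_conj_tab l1); rewrite rk cE; apply; lia.
- by move=> t /(conj_tabK k1 kr).
- by move=> t /(conj_tabK l1 lr); rewrite rk.
- exact/tab_sign_neq0/injective_adm/at_.
exists W; split=> // -[//|i] h; apply: affine_intertwine.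
have -> : 1%:M - Emx k la i.+1 =
    pmx (basis k r n la) (basis k r n la) (fun y z => (y == z)%:R - Efun R sgn r i.+1 y z).
  by rewrite -pmx1; apply/matrixP => a b; rewrite !mxE.
apply: (e (Efun R sgn r i.+1)) => y z Py Pz; have h' : (i.+1 < n)%N by lia.
have xy : X z i != X z i.+1 by apply: jm_step Pz h'.
have aE : alpha R sgn r n (conj_tab k (r - k) z) i.+1 = 1 - alpha R sgn r n z i.+1.
  rewrite !alphaE // !(jm_conj kk Pz) ?(ltnW h') //.
    by rewrite alpha_ofV ?jm_neq0.
  by rewrite (inj_eq invr_inj).
have bE : beta R sgn r n (conj_tab k (r - k) z) i.+1 = beta R sgn r n z i.+1.
  by rewrite /beta aE; congr sqrtC; ring.
rewrite /Efun (sw_conj kk h' Pz Py) aE bE.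
have -> : (conj_tab k (r - k) y == conj_tab k (r - k) z) = (y == z).
  apply/eqP/eqP => [e'|->//].
  by rewrite -(conj_tabK k1 kr Py) e' (conj_tabK k1 kr Pz).
case: (eqVneq y z) => [->|_].
  by rewrite (sw_neq R sgn r4 k1 kr Pz h') mulr1n; ring.
case: eqP => [->|_]; rewrite mulr0n; last by ring.
by rewrite tab_sign_sw //; ring.
Qed.

(** The inverse is affine in the idempotent [E], namely [q^-1 - (1 + q^-1) E], and [E] is symmetric,
    so transposing changes nothing. *)
Lemma rho_contragredient k la : (1 < k < r.-1)%N ->
  rep_equiv n (contragredient (rho k la))
    (tensor_char (fun _ => - q^-1)
       (fun i => q *: 1%:M - (1 + q) *: (1%:M - Emx k la i))).
Proof.
move=> /andP[k1 kr]; apply: eq_rep_equiv => -[//|i] h.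
have h' : (i.+1 < n)%N by lia.
have EE := Emx_idem R sgn la r4 k1 kr h'.
have q0 := qq_neq0 R sgn r4.
pose B := q^-1 *: 1%:M - (1 + q^-1) *: Emx k la i.+1.
have AB : rho k la i.+1 *m B = 1%:M.
  rewrite /B /Defs.rho idem_mul // divff // scale1r.
  rewrite (_ : q * (1 + q^-1) + (1 + q) * q^-1 - (1 + q) * (1 + q^-1) = 0).
    by rewrite scale0r subr0.
  by field.
have [uA _] := mulmx1_unit AB.
have iA : invmx (rho k la i.+1) = B by rewrite -[B](mulKmx uA) AB mulmx1.
rewrite /contragredient iA /tensor_char /B linearB /= !linearZ /= trmx1.
rewrite (Emx_sym R sgn la r4 k1 kr h').
by apply/matrixP => a b; rewrite !mxE; field.
Qed.

Lemma rho_conj_contragredient k la : (1 < k < r.-1)%N ->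
  (exists t : tab n, adm_tab k r la t) ->
  rep_equiv n (contragredient (rho k la))
    (tensor_char (fun _ => - q^-1) (rho (r - k)%N (r_conj k r la))).
Proof.
move=> kk ex; apply: rep_equiv_trans (rho_contragredient la kk) _.
by apply: rep_equiv_scale; apply: rep_equiv_sym; apply: rho_conj.
Qed.

End RepEquiv.

(** Supplies the boxes [(0, 1)] and [(1, 0)], either of which can then hold the second entry of a
    tableau. *)
Lemma nontrivial_hook k r la : is_diagram la -> ~~ trivial_type k r la ->
  (1 < nth 0%N la 0)%N /\ (0 < nth 0%N la 1)%N.
Proof.
move=> dl; rewrite /trivial_type !negb_or -ltnNge => /and3P[s1 /allPn[x xla x1] _].
split; last by case/andP: dl => _ /allP; apply; apply: mem_nth.
rewrite -ltnNge in x1; apply: leq_trans x1 _.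
by rewrite -(nth_index 0%N xla); apply: is_diagram_mono.
Qed.

(** * An intertwiner determines the diagram *)

Section Forward.
Variables (R : realType) (sgn : bool) (r n : nat).
Hypothesis r4 : (4 < r)%N.
Local Notation C := R[i].
Local Notation q := (qq R sgn r).
Local Notation X := (jm R sgn r).
Local Notation rho := (fun k => rho R sgn k r n).

(* [B := rho_1 sigma_1] satisfies [(B - c q) (B + c) = 0], and [v_t] is an
   eigenvector of [B]. *)
Lemma rho_eigen k la d (B2 : 'M[C]_d) (E2 : 'M[C]_d) (M : 'M[C]_(_, d)) (c : C)
    (t : tab n) :
  (1 < k < r.-1)%N -> (1 < n)%N -> adm_tab k r la t -> row_free M ->
  E2 *m E2 = E2 -> B2 = q *: 1%:M - (1 + q) *: E2 ->
  rho k la 1%N *m M = M *m (c *: B2) ->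
  alpha R sgn r n t 1 * (1 - alpha R sgn r n t 1) = 0 ->
  let x := q - (1 + q) * alpha R sgn r n t 1 in
  (x - c * q) * (x + c) = 0.
Proof.
move=> /andP[k1 kr] n1 Pt /row_freeP[N MN] E22 B2E e a0 x.
set A := rho k la 1%N in e.
have z2 : (c *: B2 - (c * q) *: 1%:M) *m (c *: B2 + c *: 1%:M) = 0.
  have -> : c *: B2 - (c * q) *: 1%:M = 0 *: 1%:M - (c * (1 + q)) *: E2.
    by rewrite B2E; apply/matrixP => i j; rewrite !mxE; ring.
  have -> : c *: B2 + c *: 1%:M = (c * (1 + q)) *: 1%:M - (c * (1 + q)) *: E2.
    by rewrite B2E; apply/matrixP => i j; rewrite !mxE; ring.
  by rewrite idem_mul //; apply/matrixP => i j; rewrite !mxE; ring.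
(* [M] has a right inverse, so the quadratic relation passes from [c *: B2] back to [A]. *)
have z1 : (A - (c * q) *: 1%:M) *m (A + c *: 1%:M) = 0.
  rewrite -[LHS]mulmx1 -[X in _ *m X = _]MN mulmxA -(mulmxA _ _ M).
  have -> : (A + c *: 1%:M) *m M = M *m (c *: B2 + c *: 1%:M).
    by rewrite mulmxDl mulmxDr e -!scalemxAl -!scalemxAr mul1mx mulmx1.
  rewrite mulmxA.
  have -> : (A - (c * q) *: 1%:M) *m M = M *m (c *: B2 - (c * q) *: 1%:M).
    by rewrite mulmxBl mulmxBr e -!scalemxAl -!scalemxAr mul1mx mulmx1.
  by rewrite -(mulmxA M) z2 mulmx0 mul0mx.
have Pt' : t \in basis k r n la by [].
pose o : 'I_(dimV k r n la) := enum_rank_in Pt' t.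
have oE : enum_val o = t by rewrite enum_rankK_in.
have ev : A *m delta_mx o (0 : 'I_1) = x *: delta_mx o 0.
  rewrite -colE; apply/matrixP => a j; rewrite !mxE oE /=.
  have -> : beta R sgn r n t 1 = 0 by rewrite /beta a0 sqrtC0.
  have -> : (enum_val a == t) = (a == o) by rewrite -oE (inj_eq enum_val_inj).
  rewrite if_same (ord1 j) eqxx andbT.
  by case: eqP => _; rewrite ?mulr1n ?mulr0n /x; ring.
have : (A - (c * q) *: 1%:M) *m (A + c *: 1%:M) *m delta_mx o (0 : 'I_1) = 0.
  by rewrite z1 mul0mx.
have -> : (A - (c * q) *: 1%:M) *m (A + c *: 1%:M) *m delta_mx o (0 : 'I_1)
    = ((x - c * q) * (x + c)) *: delta_mx o 0.
  rewrite -mulmxA [(A + c *: _) *m _]mulmxDl ev -[(c *: _) *m _]scalemxAl mul1mx.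
  rewrite -scalerDl -scalemxAr mulmxBl ev -[((c * q) *: _) *m _]scalemxAl mul1mx.
  by rewrite -scalerBl scalerA mulrC.
by move=> /matrixP/(_ o 0); rewrite !mxE !eqxx mulr1.
Qed.

(** Serves both parts of the theorem; the second applies it to the [r]-conjugate on the cylinder
    with [r - k2] rows. *)
Lemma diagram_of_equiv k1 k2 la1 la2 (psi : nat -> C) :
  (1 < k1 < r.-1)%N -> (1 < k2 < r.-1)%N ->
  in_Lambda k1 r n la1 -> ~~ trivial_type k1 r la1 ->
  is_character n psi ->
  rep_equiv n (rho k1 la1) (tensor_char psi (rho k2 la2)) -> la1 = la2.
Proof.
move=> kk1 kk2 L1 nt ch [M [fM _ e]].
have dl : is_diagram la1 by case/and4P: L1.
have [h0 h1] := nontrivial_hook dl nt.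
have [ta ata ea] := exists_adm_tab (b1 := (0, 1)%N) kk1 L1 isT h0.
have [tb atb eb] := exists_adm_tab (b1 := (1, 0)%N) kk1 L1 isT h1.
have /andP[k11 k1r] := kk1; have /andP[k21 k2r] := kk2.
have n1 : (1 < n)%N.
  (* For [n <= 1] the second entry would be the default box [(0, 0)]. *)
  rewrite ltnNge; apply/negP => n1; move: ea; rewrite /entry /pos insubF //.
  by rewrite ltnNge n1.
have q0 := qq_neq0 R sgn r4.
have aa : alpha R sgn r n ta 1 = 0.
  rewrite alphaE //; last exact: jm_step ata n1.
  rewrite (jm0 R sgn k11 ata) ?(ltnW n1) //.
  by rewrite [X in alpha_of _ _ _ X](_ : _ = q * 1) ?alpha_of_row // /jm ea mulr1.
have ab : alpha R sgn r n tb 1 = 1.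
  rewrite alphaE //; last exact: jm_step atb n1.
  rewrite (jm0 R sgn k11 atb) ?(ltnW n1) //.
  rewrite [X in alpha_of _ _ X](_ : _ = q * X tb 1) ?alpha_of_col ?jm_neq0 //.
  by rewrite /jm eb /content /= mulfV.
have EE := Emx_idem R sgn la2 r4 k21 k2r n1.
(* The eigenvalues [q] (from [ta]) and [-1] (from [tb]) are both roots of [(x - c q)(x + c)]. If [c]
   is not 1, then [c = - q] and [c q = -1], contradicting [q ^+ 2 != 1]. *)
have c1 : psi 1%N = 1.
  have := rho_eigen (la := la1) kk1 n1 ata fM EE erefl (e 1%N n1).
  rewrite aa mul0r => /(_ erefl) ha.
  have := rho_eigen (la := la1) kk1 n1 atb fM EE erefl (e 1%N n1).
  rewrite ab subrr mulr0 => /(_ erefl) hb.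
  move: ha hb => /=; move: (psi 1%N) => c.
  rewrite mulr0 subr0 mulr1 opprD addrCA subrr addr0.
  move=> /eqP; rewrite mulf_eq0 => /orP[ha _|ha /eqP].
    apply/esym/eqP; rewrite -subr_eq0 -(inj_eq (mulIf q0)) mul0r.
    by rewrite mulrBl mul1r.
  rewrite mulf_eq0 => /orP[hb|]; last by rewrite addrC subr_eq0 => /eqP.
  have cE : c = - q by apply/eqP; rewrite -addr_eq0 addrC.
  move: hb; rewrite cE mulNr opprK addrC subr_eq0 -expr2.
  by rewrite (negbTE (qq2_neq1 R sgn r4)).
have {}e i : (0 < i < n)%N -> rho k1 la1 i *m M = M *m rho k2 la2 i.
  by move=> h; rewrite e // /tensor_char (character_const ch h) c1 scale1r.
have DM m : (m < n)%N -> Dmx R sgn k1 r n la1 m *m M = M *m Dmx R sgn k2 r n la2 m.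
  elim: m => [|m IH] mn.
    apply/matrixP => a b; rewrite mul_diag_mx mul_mx_diag !mxE.
    by rewrite (jm0 R sgn k11 (enum_valP a)) // (jm0 R sgn k21 (enum_valP b)) //
         mulr1 mul1r.
  (* [U] is [B + 1 - q]. It is intertwined by [M] along with [B], and its invertibility isolates the
     next Jucys-Murphy matrix in [Dmx_step]. *)
  pose U k la := 1%:M - (1 + q) *: Emx R sgn k r n la m.+1.
  have UM : U k1 la1 *m M = M *m U k2 la2.
    have UE k la : U k la = rho k la m.+1 + (1 - q) *: 1%:M.
      by apply/matrixP => a b; rewrite !mxE; ring.
    by rewrite !UE mulmxDl mulmxDr e // -scalemxAl -scalemxAr mul1mx mulmx1.
  have UV : U k2 la2 *m (1%:M - (1 + q^-1) *: Emx R sgn k2 r n la2 m.+1) = 1%:M.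
    have := idem_mul 1 (1 + q) 1 (1 + q^-1) (Emx_idem R sgn la2 r4 k21 k2r mn).
    rewrite !scale1r => ->; rewrite mulr1 scale1r.
    rewrite (_ : 1 * (1 + q^-1) + (1 + q) * 1 - (1 + q) * (1 + q^-1) = 0).
      by rewrite scale0r subr0.
    by field.
  rewrite -[LHS]mulmx1 -UV mulmxA -(mulmxA _ M) -UM (mulmxA _ (U _ _)).
  rewrite -(Dmx_step R sgn la1 r4 k11 k1r mn) -(mulmxA _ _ M) IH; last exact: ltnW.
  rewrite (mulmxA _ M) e // -(mulmxA M) (Dmx_step R sgn la2 r4 k21 k2r mn).
  by rewrite -!mulmxA UV mulmx1.
have [N MN] := row_freeP fM.
pose o : 'I_(dimV k1 r n la1) := enum_rank_in (ata : ta \in basis k1 r n la1) ta.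
have [b Mb] : exists b, M o b != 0.
  apply/existsP; apply: contraT => /existsPn M0.
  have := congr1 (fun A : 'M_ _ => A o o) MN; rewrite !mxE eqxx big1.
    by move/esym/eqP; rewrite oner_eq0.
  by move=> j _; have := M0 j; rewrite negbK => /eqP->; rewrite mul0r.
have [g1 d1 E1] := adm_tab_growth k11 (enum_valP o : adm_tab k1 r la1 _).
have [g2 d2 E2] := adm_tab_growth k21 (enum_valP b : adm_tab k2 r la2 _).
have kl1 : (k1 + (r - k1) = r)%N by lia.
have kl2 : (k2 + (r - k2) = r)%N by lia.
(* At a nonzero entry of [M], commutation with the diagonal matrices equates the Jucys-Murphy
   eigenvalues of the row and column tableaux. *)
have eqT : mkseq (entry (enum_val o)) n = mkseq (entry (enum_val b)) n.
  apply: (growth_unique g1 g2); rewrite ?kl1 ?kl2 // => m mn.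
  rewrite -(jm_eq R sgn r4); have := congr1 (fun A : 'M_(_, _) => A o b) (DM m mn).
  rewrite mul_diag_mx mul_mx_diag !mxE mulrC => /(mulfI Mb) ->; exact: eqxx.
by apply: is_diagram_ext => // i; rewrite E1 E2 /row_len eqT.
Qed.

End Forward.

Theorem theorem3p5 (R : realType) (sgn : bool) (r k1 k2 n : nat)
    (la1 la2 : seq nat) :
  (4 < r)%N -> (1 < k1 < r.-1)%N -> (1 < k2 < r.-1)%N ->
  in_Lambda k1 r n la1 -> in_Lambda k2 r n la2 ->
  ~~ trivial_type k1 r la1 -> ~~ trivial_type k2 r la2 ->
  ((exists psi : nat -> R[i], is_character n psi /\
      rep_equiv n (rho R sgn k1 r n la1)
        (tensor_char psi (rho R sgn k2 r n la2)))
     <-> la1 = la2)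
  /\
  ((exists psi : nat -> R[i], is_character n psi /\
      rep_equiv n (rho R sgn k1 r n la1)
        (tensor_char psi (contragredient (rho R sgn k2 r n la2))))
     <-> la1 = r_conj k2 r la2).
Proof.
move=> r4 kk1 kk2 L1 L2 nt1 nt2.
have cst (c : R[i]) : c != 0 -> is_character n (fun _ => c) by move=> c0; split.
have q0 := qq_neq0 R sgn r4; have q0' : - (qq R sgn r)^-1 != 0.
  by rewrite oppr_eq0 invr_eq0.
split; split.
- by case=> psi [ch e]; apply: diagram_of_equiv e.
- move=> e; exists (fun _ => 1); split; first exact/cst/oner_neq0.
  apply: (@rep_equiv_trans _ _ _ _ _ _ (rho R sgn k2 r n la2)).
    by rewrite -e; apply: rho_indep => //; rewrite e.
  by apply: eq_rep_equiv => i _; rewrite /tensor_char scale1r.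
- have ex2 : exists t : tab n, adm_tab k2 r la2 t.
    have [h0 _] := nontrivial_hook (proj1 (andP L2)) nt2.
    by have [t at_ _] := exists_adm_tab (b1 := (0, 1)%N) kk2 L2 isT h0; exists t.
  case=> psi [ch e].
  (* The contragredient is the conjugate sector twisted by [- q^-1], so [psi] times this constant is
     the new character. *)
  have := rep_equiv_trans e (rep_equiv_scale psi (rho_conj_contragredient R sgn r4 kk2 ex2)).
  move=> e2; apply: (@diagram_of_equiv R sgn r n r4 k1 (r - k2)%N _ _
    (fun i => psi i * - (qq R sgn r)^-1)) => //; first by lia.
    case: ch => c1 c2 c3; split=> [i h|i j hi hj _|i h1 h2].
    + by rewrite mulf_neq0 // c1.
    + exact: mulrC.
    (* The constant enters both sides of the braid relation as its cube. *)
    + by have := c3 i h1 h2; move: (_^-1) => v h3; ring: h3.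
  apply: rep_equiv_trans e2 _; apply: eq_rep_equiv => i _.
  by rewrite /tensor_char scalerA.
- have ex2 : exists t : tab n, adm_tab k2 r la2 t.
    have [h0 _] := nontrivial_hook (proj1 (andP L2)) nt2.
    by have [t at_ _] := exists_adm_tab (b1 := (0, 1)%N) kk2 L2 isT h0; exists t.
  (* The value [- q] cancels the twist [- q^-1] of the contragredient. *)
  move=> e; exists (fun _ => - qq R sgn r); split; first by apply: cst; rewrite oppr_eq0.
  have L1' : in_Lambda (r - k2) r n la1.
    have [t at_] := ex2; rewrite e; apply: in_Lambda_r_conj at_; lia.
  have lk : (1 < r - k2 < r.-1)%N by lia.
  apply: rep_equiv_trans (rho_indep R sgn r4 kk1 lk L1 L1') _.
  apply: rep_equiv_sym; rewrite e.
  apply: rep_equiv_trans (rep_equiv_scale _ (rho_conj_contragredient R sgn r4 kk2 ex2)) _.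
  apply: eq_rep_equiv => i _; rewrite /tensor_char scalerA mulrNN divff //.
  by rewrite scale1r.
Qed.
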